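(* Fix $d \geq 2$. Let $\mathcal{Y}_d(n) = \big(Y_d(n,0) \subseteq Y_d(n,1) \subseteq \cdots \subseteq Y_d(n,\binom{n}{d+1})\big)$ be the Linial--Meshulam stochastic process. With high probability (i.e. with probability tending to $1$ as $n \to \infty$), the hitting time for the property that no $(d-1)$-dimensional face is isolated coincides exactly with the hitting time for the property $H_{d-1}(\,\cdot\,;\mathbb{Z}) = 0$. That is, with high probability, $H_{d-1}(Y_d(n,m);\mathbb{Z})$ first vanishes exactly at the step $m$ at which the last isolated $(d-1)$-dimensional face becomes covered by a $d$-dimensional face.
   Context: The Linial--Meshulam stochastic process $\mathcal{Y}_d(n)$ is the Markov process in which $Y_d(n,0)$ is the complete $(d-1)$-dimensional complex on $n$ vertices (the $(d-1)$-skeleton of the $(n-1)$-simplex), and $Y_d(n,k)$ is obtained from $Y_d(n,k-1)$ by adding one $d$-dimensional face chosen uniformly at random among all $d$-dimensional faces (of the simplex on the $n$ vertices) not already in $Y_d(n,k-1)$. For a property $P$, the hitting time of $P$ is the minimal $m$ such that $Y_d(n,m)$ has $P$. A $(d-1)$-dimensional face is isolated if it is not contained in any $d$-dimensional face of the complex. *)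

(* Defs.v *)
From HB Require Import structures.
From mathcomp Require Import all_boot all_order all_algebra.
From Stdlib Require Import ClassicalEpsilon.
Set Implicit Arguments. Unset Strict Implicit. Unset Printing Implicit Defensive.
Import Order.TTheory GRing.Theory Num.Theory.
Local Open Scope ring_scope.

Definition is_face (n k : nat) (s : {set 'I_n}) : bool := #|s| == k.+1.

(* Integer chains: finitely supported integer functions on vertex sets,
   a set s of size k+1 standing for the oriented simplex with vertices
   listed in increasing order. *)
Definition chain (n : nat) := {ffun {set 'I_n} -> int}.

(* Simplicial boundary: d[v_0 < ... < v_k] = sum_i (-1)^i [.. v_i omitted ..].
   (bd c)(t) = sum_{v notin t} (-1)^(position of v in t+v) c(t + v). *)
Definition bd (n : nat) (c : chain n) : chain n :=
  [ffun t : {set 'I_n} =>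
     \sum_(v : 'I_n | v \notin t)
        ((-1) ^+ #|[set u in t | (val u < val v)%N]| * c (v |: t))].

(* The complex Y_d(n,m) along a trajectory w (the sequence of added d-faces):
   full (d-1)-skeleton together with the d-faces in take m w. *)

Definition no_isolated (n d : nat) (Yd : seq {set 'I_n}) : Prop :=
  forall t : {set 'I_n}, is_face d.-1 t -> exists2 s, s \in Yd & t \subset s.

(* H_{d-1}(Y; Z) = 0, i.e. every (d-1)-cycle is the boundary of an integer
   d-chain supported on the d-faces of Y (the (d-1)-skeleton being full). *)
Definition Hvanish (n d : nat) (Yd : seq {set 'I_n}) : Prop :=
  forall z : chain n,
    (forall t, z t != 0 -> is_face d.-1 t) -> bd z = 0 ->
    exists c : chain n,
      (forall s, c s != 0 -> (s \in Yd) && is_face d s) /\ bd c = z.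

Definition Nfaces (n d : nat) : nat := 'C(n, d.+1).

Definition trajectory (n d : nat) (w : (Nfaces n d).-tuple {set 'I_n}) : bool :=
  uniq w && all (is_face d) w.

(* Markov-chain probability of a trajectory: at step k the next face is
   uniform among the d-faces not yet present. *)
Definition traj_weight (n d : nat) (w : (Nfaces n d).-tuple {set 'I_n}) : rat :=
  \prod_(k < Nfaces n d)
     (#|[set s : {set 'I_n} | is_face d s & s \notin take k w]|%:R)^-1.

Definition pbool (P : Prop) : bool :=
  if excluded_middle_informative P then true else false.

Definition LMprob (n d : nat) (E : (Nfaces n d).-tuple {set 'I_n} -> Prop) : rat :=
  \sum_(w | trajectory w) traj_weight w * (pbool (E w))%:R.

Definition hitting_time (n d : nat) (w : (Nfaces n d).-tuple {set 'I_n})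
    (P : seq {set 'I_n} -> Prop) (m : nat) : Prop :=
  (m <= Nfaces n d)%N /\ P (take m w) /\ (forall k, (k < m)%N -> ~ P (take k w)).

Definition hitting_times_coincide (n d : nat)
    (w : (Nfaces n d).-tuple {set 'I_n}) : Prop :=
  exists m, hitting_time w (@no_isolated n d) m /\ hitting_time w (@Hvanish n d) m.

(* Main.v *)
(* Let [Y] be the binomial random set of d-faces with [(1 - p) ^+ (n - d) = n ^ (1/8 - d)],
   i.e. the process stopped at an independent binomial time.  With high probability [Y] has an
   isolated (d-1)-face (second moment), so the time at which the last one gets covered comes
   later, and it suffices that [Y] satisfies a property guaranteeing that, for every larger
   complex without isolated (d-1)-faces, the integral homology vanishes.

   If it does not vanish, Smith's normal form yields a cocycle with values in some Z/e that does
   not vanish on all cycles; take it of minimal support [K] modulo coboundaries.  The cone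
   homotopy shows that its coboundary has at least [n #|K| / (d + 1)] faces; it also contains all
   faces having exactly one facet in [K].  All of them are missing from [Y].

   If [K] is small, one may assume that no element of [K] is isolated in the adjacency graph of
   (d-1)-faces; such a [K] has a dominating subset of at most half its size, so there are few of
   them and a union bound over [K] suffices, independently of the coefficients.

   If [K] is large, the elements of [K] with many neighbours in [K] are dominated by few elements
   of [K], which makes the number of possible [K] small enough against the number of missing
   faces.  The coefficients are handled uniformly: the set of missing faces is determined by a
   subset [B] of [Y] whose boundaries span, over the integers and restricted to [K], those of
   [Y], and a pigeonhole on subset sums shows that [B] can be chosen with [O(#|K|)] elements. *)
Require Import Defs.
From mathcomp Require Import all_boot all_order all_algebra.
From mathcomp Require Import ring lra zify.
From mathcomp Require Import Rstruct reals sequences exp.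
From Stdlib Require Import ClassicalEpsilon.
Set Implicit Arguments. Unset Strict Implicit. Unset Printing Implicit Defensive.
Import Order.TTheory GRing.Theory Num.Theory.
Local Open Scope ring_scope.

(** * Coboundaries *)

Section Coboundary.
Variables (R : comNzRingType) (n : nat).
Implicit Types (f g : {set 'I_n} -> R) (v u : 'I_n) (s t : {set 'I_n}).

(** The sign only sees members of [s] below [v], so it is the same for [s :\ v], [s] and [v |: s].
    Sets of all sizes, the empty one included, are treated at once: this is the augmented cochain
    complex of the simplex, so [cone_homotopy] has no exceptional degree. *)
Definition inc_sign v s : R := (-1) ^+ #|[set u in s | (val u < val v)%N]|.

Definition cobd f s : R := \sum_(v in s) inc_sign v s * f (s :\ v).

Definition cone v f t : R := if v \in t then 0 else inc_sign v t * f (v |: t).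

Lemma inc_sign_sq v s : inc_sign v s * inc_sign v s = 1.
Proof. by rewrite -expr2 sqrr_sign. Qed.

Lemma inc_signU u v s : v \notin s ->
  inc_sign u (v |: s) = (-1) ^+ (val v < val u)%N * inc_sign u s.
Proof.
move=> vs; rewrite /inc_sign -exprD; congr (_ ^+ _).
have [vu|uv] := boolP (val v < val u)%N.
  have -> : [set u0 in v |: s | (val u0 < val u)%N] =
            v |: [set u0 in s | (val u0 < val u)%N].
    by apply/setP => z; rewrite !inE andb_orl; case: eqP => // ->; rewrite vu.
  by rewrite cardsU1 inE (negbTE vs).
rewrite add0n; apply: eq_card => z; rewrite !inE andb_orl.
by case: eqP => // ->; rewrite (negbTE uv) andbF.
Qed.

Lemma inc_signD1 v s : inc_sign v (s :\ v) = inc_sign v s.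
Proof.
rewrite /inc_sign; congr (_ ^+ _); apply: eq_card => z; rewrite !inE.
by case: eqP => // ->; rewrite ltnn !andbF.
Qed.

Lemma inc_signU1 v s : inc_sign v (v |: s) = inc_sign v s.
Proof.
rewrite /inc_sign; congr (_ ^+ _); apply: eq_card => z; rewrite !inE.
by case: eqP => // ->; rewrite ltnn !andbF.
Qed.

Lemma eq_cobd f g : f =1 g -> cobd f =1 cobd g.
Proof. by move=> fg s; apply: eq_bigr => v _; rewrite fg. Qed.

Lemma cobdB f g s : cobd (fun t => f t - g t) s = cobd f s - cobd g s.
Proof. by rewrite /cobd -sumrB; apply: eq_bigr => v _; rewrite mulrBr. Qed.

(** Exactly one of [u < v] and [v < u] holds, so inserting [v] and deleting [u] flips exactly one of
    the two signs. *)
Lemma inc_sign_swap u v s : u \in s -> v \notin s ->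
  inc_sign v s * inc_sign u (v |: s) = - (inc_sign u s * inc_sign v (s :\ u)).
Proof.
move=> us vs; rewrite inc_signU //.
rewrite -{1}(setD1K us) inc_signU ?setD11 //.
have [uv|vu|/val_inj E] := ltngtP (val u) (val v).
- by rewrite /=; ring.
- by rewrite /=; ring.
by rewrite -E us in vs.
Qed.

(** If [v] is in [t], every facet other than [t :\ v] contains [v], and the cone vanishes there.
    Otherwise the terms for [u] in [t] cancel in pairs, and the facet [t] of [v |: t] gives
    [f t]. *)
Lemma cone_homotopy v f t : cobd (cone v f) t + cone v (cobd f) t = f t.
Proof.
rewrite {2}/cone; case: ifPn => vt.
  rewrite addr0 /cobd (bigD1 v) //= big1 ?addr0.
    by rewrite /cone setD11 inc_signD1 setD1K // mulrA inc_sign_sq mul1r.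
  move=> u /andP[ut uv]; rewrite /cone ifT ?mulr0 //.
  by rewrite !inE eq_sym uv.
rewrite /cobd big_setU1 //= inc_signU1 setU1K // mulrDr mulrA inc_sign_sq mul1r.
rewrite [f t + _]addrC addrA -[RHS]add0r; congr (_ + _).
rewrite big_distrr -big_split big1 //= => u ut.
have uv : u != v by apply: contraNneq vt => <-.
rewrite /cone ifF; last by rewrite !inE (negbTE vt) andbF.
have -> : v |: t :\ u = (v |: t) :\ u.
  by apply/setP => z; rewrite !inE; have [->|] := eqVneq z v; rewrite // eq_sym uv.
rewrite !mulrA inc_sign_swap //; ring.
Qed.

(** The homotopy, applied to [f] and to [cobd f], shows that [cone v] commutes with the square of
    [cobd]. The value at [s] is thus, up to sign, a value of the square at the smaller set
    [s :\ v]. *)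
Lemma cobd_cobd f s : cobd (cobd f) s = 0.
Proof.
have [k] := ubnP #|s|; elim: k f s => // k IHk f s ltsk.
have [->|[v vs]] := set_0Vmem s; first by rewrite /cobd big_set0.
have comm t : cone v (cobd (cobd f)) t = cobd (cobd (cone v f)) t.
  have h : cobd (cobd (cone v f)) t + cobd (cone v (cobd f)) t = cobd f t.
    rewrite -[RHS](eq_cobd (cone_homotopy v f)) /cobd -big_split.
    by apply: eq_bigr => u _; rewrite mulrDr.
  move: (cone_homotopy v (cobd f) t); rewrite -{}h addrC.
  by move/addIr.
have := comm (s :\ v); rewrite IHk; last first.
  by rewrite (cardsD1 v s) vs in ltsk.
rewrite /cone setD11 setD1K // => /(congr1 ( *%R (inc_sign v (s :\ v)))).
by rewrite mulrA inc_sign_sq mul1r mulr0.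
Qed.

Lemma cobd_card_support k f s :
  (forall t, f t != 0 -> #|t| = k) -> cobd f s != 0 -> #|s| = k.+1.
Proof.
move=> fk; apply: contraNeq => sk; rewrite /cobd big1 // => v vs.
have [->|/fk E] := eqVneq (f (s :\ v)) 0; first by rewrite mulr0.
by rewrite (cardsD1 v) vs E eqxx in sk.
Qed.

Lemma cobd_bd_adjoint f (c : chain n) :
  \sum_s cobd f s * (c s)%:~R = \sum_t f t * (bd c t)%:~R.
Proof.
rewrite /cobd.
under eq_bigr do rewrite big_distrl /=.
under [RHS]eq_bigr => t _ do
  rewrite ffunE rmorph_sum big_distrr /=.
rewrite (exchange_big_dep xpredT) //= [RHS](exchange_big_dep xpredT) //=.
apply: eq_bigr => v _.
rewrite [LHS](reindex_onto (fun t => v |: t) (fun s => s :\ v)) /=; last first.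
  by move=> s vs; rewrite setD1K.
apply: eq_big => t.
  rewrite setU11 /=; apply/eqP/idP => [<-|vt]; first by rewrite setD11.
  by rewrite setU1K.
rewrite setU11 /= => /eqP E; have vt : v \notin t by rewrite -E setD11.
rewrite setU1K // inc_signU1 rmorphM rmorphXn rmorphN1 /inc_sign; ring.
Qed.

End Coboundary.

Lemma bd_bd n (c : chain n) : bd (bd c) = 0.
Proof.
apply/ffunP => t; rewrite [RHS]ffunE.
(* Pairing with the indicator of [t] reads off the coefficient at [t] and moves both boundaries onto
   a cochain. *)
pose f := fun t' : {set 'I_n} => ((t' == t)%:R : int).
have : \sum_s f s * (bd (bd c) s)%:~R = 0.
  rewrite -cobd_bd_adjoint -cobd_bd_adjoint big1 // => s _.
  by rewrite cobd_cobd mul0r.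
rewrite (bigD1 t) //= big1 ?addr0 /f ?eqxx ?mul1r ?intz // => s st.
by rewrite (negbTE st) mul0r.
Qed.

(** * Supports of cochains and expansion *)

Section Support.
Variables (R : comNzRingType) (n : nat).
Implicit Types (f g h : {set 'I_n} -> R) (v u : 'I_n) (s t : {set 'I_n}).

Definition supp f : {set {set 'I_n}} := [set t | f t != 0].

Lemma cone_card_support d v f t :
  (forall t, f t != 0 -> #|t| = d) -> cone v f t != 0 -> #|t| = d.-1.
Proof.
move=> fd; rewrite /cone; case: ifPn => [_|vt]; first by rewrite eqxx.
have [->|/fd <- _] := eqVneq (f (v |: t)) 0; first by rewrite mulr0 eqxx.
by rewrite cardsU1 vt.
Qed.

(* Subtracting [cobd (cone v f)] from [f] leaves [cone v (cobd f)], whose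
   support injects into the faces of [supp (cobd f)] through [v]; average over [v]. *)
Lemma minimal_supp_le d f :
  (forall t, f t != 0 -> #|t| = d) ->
  (forall h, (forall t, h t != 0 -> #|t| = d.-1) ->
     (#|supp f| <= #|supp (fun t => f t - cobd h t)%R|)%N) ->
  (n * #|supp f| <= d.+1 * #|supp (cobd f)|)%N.
Proof.
move=> fd fmin.
have bound v : (#|supp f| <= #|[set s in supp (cobd f) | v \in s]|)%N.
  apply: leq_trans (fmin (cone v f) (fun t => cone_card_support fd)) _.
  rewrite -(@card_in_imset _ _ (fun t => v |: t)); last first.
    move=> t1 t2; rewrite !inE => + + E.
    have aux t : f t - cobd (cone v f) t != 0 -> v \notin t.
      rewrite -{1}(cone_homotopy v f t) addrC addrA addNr add0r /cone.
      by case: ifP; rewrite ?eqxx.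
    by move=> /aux v1 /aux v2; rewrite -(setU1K v1) E setU1K.
  apply/subset_leq_card/subsetP => _ /imsetP[t + ->]; rewrite !inE eqxx andbT.
  rewrite -{1}(cone_homotopy v f t) addrC addrA addNr add0r /cone.
  case: ifP; rewrite ?eqxx // => _.
  by apply: contraNneq => ->; rewrite mulr0.
have -> : (d.+1 * #|supp (cobd f)| = \sum_(s in supp (cobd f)) #|s|)%N.
  rewrite mulnC -sum_nat_const; apply: eq_bigr => s; rewrite inE.
  by move/(cobd_card_support fd).
have -> : (\sum_(s in supp (cobd f)) #|s| =
           \sum_(v : 'I_n) #|[set s in supp (cobd f) | v \in s]|)%N.
  under eq_bigr do rewrite -sum1_card.
  rewrite (exchange_big_dep xpredT) //=; apply: eq_bigr => v _.
  by rewrite -sum1_card; apply: eq_bigl => s; rewrite [RHS]inE.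
rewrite -[n in (n * _)%N]card_ord -sum_nat_const.
by apply: leq_sum => v _.
Qed.

End Support.

(** * Duality between integral boundaries and cocycles in finite cyclic coefficients *)

Lemma intr_Zp_eq0 e (x : int) : (x%:~R == 0 :> 'Z_e.+2) = (e.+2 %| x)%Z.
Proof.
have nat_case k : (k%:R == 0 :> 'Z_e.+2) = (e.+2 %| k)%N.
  by rewrite -val_eqE /= val_Zp_nat.
by case: x => k; rewrite ?NegzE ?rmorphN ?oppr_eq0 /= -?pmulrn nat_case dvdzE.
Qed.

(** In Smith coordinates the system is solvable iff each diagonal entry divides the corresponding
    coordinate of [w], where [L *m w = z]. A failing coordinate, read modulo a suitable number, is
    the functional [g]. *)
Lemma lattice_dual m l (M : 'M[int]_(m, l)) (z : 'cV[int]_m) :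
  (forall c : 'cV[int]_l, M *m c <> z) ->
  exists e : nat, exists g : 'rV['Z_e.+2]_m,
    g *m map_mx intr M = 0 /\ g *m map_mx intr z != 0.
Proof.
have [L uL [R uR [D _ ->]]] := int_Smith_normal_form M => nz.
have [w Lw] : exists w, L *m w = z by exists (invmx L *m z); rewrite mulKVmx.
(* Rows beyond the last column count as having a zero diagonal entry: there solvability forces the
   coordinate of [w] to vanish. *)
pose D' i := if (i < l)%N then D`_i else 0.
have [i Di] : exists i : 'I_m, ~~ (D' i %| w i ord0)%Z.
  apply/existsP; apply/negbNE/negP => /existsPn Dw.
  pose c' : 'cV[int]_l := \col_j if insub (val j) is Some i
                                then (w i ord0 %/ D`_j)%Z else 0.
  apply: (nz (invmx R *m c')).
  rewrite -!mulmxA [R *m _]mulmxA mulmxV // mul1mx -Lw.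
  congr (_ *m _); apply/matrixP => i k; rewrite ord1 !mxE {k}.
  have := Dw i; rewrite negbK /D'; case: ltnP => [il|li] dvd.
    rewrite (bigD1 (Ordinal il)) //= big1 ?addr0 => [|j ji].
      rewrite !mxE /= eqxx mulr1n valK mulrC divzK //.
    by rewrite !mxE (_ : _ == _ = false) ?mulr0n ?mul0r // eq_sym; exact: negbTE.
  rewrite dvd0z in dvd; rewrite (eqP dvd) big1 // => j _.
  rewrite !mxE (_ : _ == _ = false) ?mulr0n ?mul0r //.
  by apply/negbTE; rewrite neq_ltn (leq_trans (ltn_ord j) li) orbT.
(* The modulus is the absolute value of the diagonal entry or, if that is zero, one more than that
   of the coordinate of [w]. *)
have [e [dvdD ndvdw]] : exists e, (e.+2 %| D' i)%Z /\ ~~ (e.+2 %| w i ord0)%Z.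
  have [D0|D0] := eqVneq (D' i) 0.
    rewrite D0 dvd0z in Di; exists `|w i ord0|.-1; rewrite D0 dvdz0; split=> //.
    rewrite -absz_gt0 in Di; rewrite dvdzE /=; apply/negP => /(dvdn_leq Di).
    by rewrite prednK // ltnn.
  have : (1 < `|D' i|)%N.
    rewrite ltn_neqAle absz_gt0 D0 andbT; apply: contra Di => /eqP D1.
    by rewrite dvdzE -D1 dvd1n.
  move=> D1; exists `|D' i|.-2; rewrite !dvdzE /= in Di *.
  by case: (`|D' i|)%N D1 Di => [|[|k]] //= _ ->.
exists e, (map_mx intr (row i (invmx L))); rewrite -!map_mxM.
rewrite -Lw -!row_mul -!mulmxA !mulKmx //; split; last first.
  apply/eqP => /matrixP /(_ ord0 ord0); rewrite !mxE.
  by move/eqP; rewrite intr_Zp_eq0 (negbTE ndvdw).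
apply/matrixP => k j; rewrite !mxE; apply/eqP; rewrite intr_Zp_eq0.
apply: rpred_sum => j' _; rewrite !mxE.
have [E|] := eqVneq (i : nat) j'; last by rewrite mulr0n mul0r dvdz0.
by rewrite mulr1n dvdz_mulr //; move: dvdD; rewrite /D' E ltn_ord.
Qed.

Definition simplex_chain n (s : {set 'I_n}) : chain n := [ffun t => (t == s)%:R].

Lemma bd_expand n (c : chain n) t :
  bd c t = \sum_s c s * bd (simplex_chain s) t.
Proof.
rewrite ffunE.
under [RHS]eq_bigr => s _ do rewrite ffunE big_distrr /=.
rewrite exchange_big /=; apply: eq_bigr => v _.
rewrite (bigD1 (v |: t)) //= big1 => [|s sv]; last first.
  by rewrite ffunE eq_sym (negbTE sv) !mulr0.
by rewrite ffunE eqxx mulr1 addr0 mulrC.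
Qed.

Lemma cobd_expand (R : comNzRingType) n (f : {set 'I_n} -> R) s :
  cobd f s = \sum_t f t * (bd (simplex_chain s) t)%:~R.
Proof.
rewrite -cobd_bd_adjoint (bigD1 s) //= big1 => [|u us]; last first.
  by rewrite ffunE (negbTE us) mulr0.
by rewrite ffunE eqxx mulr1 addr0.
Qed.

(** This is [lattice_dual] for the boundary matrix with the columns outside [Yd] set to zero. *)
Lemma chain_dual n (Yd : pred {set 'I_n}) (z : chain n) :
  (forall c : chain n, (forall s, c s != 0 -> Yd s) -> bd c <> z) ->
  exists e (f : {set 'I_n} -> 'Z_e.+2),
    (forall s, Yd s -> cobd f s = 0) /\ \sum_t f t * (z t)%:~R != 0.
Proof.
move=> nz; pose T : finType := {set 'I_n}.
pose M : 'M[int]_(#|T|, #|T|) := \matrix_(i, j)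
  if Yd (enum_val j) then bd (simplex_chain (enum_val j : T)) (enum_val i) else 0.
pose z' : 'cV[int]_#|T| := \col_i z (enum_val i).
have /lattice_dual [e [g [gM gz]]] : forall c : 'cV[int]_#|T|, M *m c <> z'.
  move=> c Mc; pose c' : chain n := [ffun s => if Yd s then c (enum_rank s) ord0 else 0].
  apply: (nz c') => [s|]; first by rewrite ffunE; case: ifP.
  apply/ffunP => t; rewrite bd_expand.
  move/matrixP/(_ (enum_rank t) ord0): Mc; rewrite !mxE enum_rankK => <-.
  rewrite (reindex_onto enum_val enum_rank) /= => [|s _]; last by rewrite enum_rankK.
  apply: eq_big => [j|j _]; first by rewrite enum_valK eqxx.
  rewrite ffunE !mxE enum_valK enum_rankK.
  by case: ifP => _; rewrite ?mul0r // mulrC.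
exists e, (fun t => g ord0 (enum_rank t)); split=> [s Ys|].
  move/matrixP/(_ ord0 (enum_rank s)): gM; rewrite !mxE => <-.
  rewrite cobd_expand (reindex_onto enum_val enum_rank) /= => [|t _]; last first.
    by rewrite enum_rankK.
  apply: eq_big => [j|j _]; first by rewrite enum_valK eqxx.
  by rewrite !mxE enum_rankK enum_valK Ys.
apply: contraNneq gz => gz0; apply/eqP/matrixP => i j; rewrite !ord1 !mxE -[RHS]gz0.
rewrite [RHS](reindex_onto enum_val enum_rank) /= => [|t _]; last by rewrite enum_rankK.
apply: eq_big => [k|k _]; first by rewrite enum_valK eqxx.
by rewrite !mxE enum_valK.
Qed.

(** * Pigeonhole on subset counts *)

Section Collision.
Variables (I T : finType).

(** With [q = l %/ j] one has [l.+1 <= j * q.+1 <= j * 2 ^ q.+1]; raise this to the power [j]. *)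
Lemma exp_affine_bound j l : (0 < j)%N -> (l.+1 ^ j <= (2 * j) ^ j * 2 ^ l)%N.
Proof.
move=> j0; rewrite -{2}(expn1 2) -?expnMn.
have h : (l.+1 <= j * 2 ^ (l %/ j).+1)%N.
  rewrite {1}(divn_eq l j).
  have := ltn_expl (l %/ j).+1 (isT : (1 < 2)%N).
  have := ltn_pmod l j0; nia.
apply: leq_trans (_ : ((j * 2 ^ (l %/ j).+1) ^ j <= _)%N); first by rewrite leq_exp2r.
rewrite expn1 !expnMn -expnM mulSn expnD mulnA [(2 ^ j * _)%N]mulnC leq_mul2l.
by apply/orP; right; rewrite leq_exp2l // leq_trunc_div.
Qed.

(* Otherwise the vectors of counts would distinguish all [2 ^ #|B|] subsets of [B]. *)
Lemma subset_count_collision (K : {set I}) (B : {set T}) (r : I -> {set T}) D :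
  (forall b, b \in B -> (#|[set i in K | b \in r i]| <= D)%N) ->
  (2 * D.+1 ^ 2 * #|K| < #|B|)%N ->
  exists B1 B2 : {set T}, [/\ B1 \subset B, B2 \subset B, B1 != B2 &
    forall i, i \in K -> #|B1 :&: r i| = #|B2 :&: r i|].
Proof.
move=> rD ltB.
pose l i := #|B :&: r i|.
pose code (B' : {set T}) : {ffun I -> 'I_#|T|.+1} :=
  [ffun i => if i \in K then inord #|B' :&: r i| else ord0].
have codeE (B' : {set T}) i : i \in K -> code B' i = #|B' :&: r i| :> nat.
  by move=> iK; rewrite ffunE iK inordK // ltnS max_card.
have [/dinjectiveP inj|/dinjectivePn[B1 B1B [B2 /andP[/= B21 B2B] E]]] :=
    boolP (dinjectiveb code (powerset B)); last first.
  exists B1, B2; rewrite !inE in B1B B2B; split=> // [|i iK].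
    by rewrite eq_sym.
  by rewrite -!codeE // E.
exfalso; move: ltB; rewrite ltnNge => /negP; apply.
pose F i : pred 'I_#|T|.+1 := [pred k : 'I_#|T|.+1 | (k <= l i)%N].
have : (2 ^ #|B| <= \prod_(i in K) (l i).+1)%N.
  rewrite -card_powerset -(card_in_imset inj).
  apply: (@leq_trans #|pfamily ord0 K F|).
    apply/subset_leq_card/subsetP => _ /imsetP[B' + ->]; rewrite inE => B'B.
    apply/pfamilyP; split=> [|i iK].
      by apply/supportP => i iK; rewrite ffunE (negbTE iK).
    by rewrite inE codeE //= subset_leq_card // setSI.
  rewrite card_pfamily foldrE big_map big_enum /=; apply: leq_prod => i _.
  have le_l : ((l i).+1 <= #|T|.+1)%N by rewrite ltnS max_card.
  rewrite -[X in (_ <= X)%N]card_ord.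
  apply: leq_trans (leq_image_card (widen_ord le_l) _).
  apply/subset_leq_card/subsetP => k; rewrite inE => kl.
  have kl' : (k < (l i).+1)%N by [].
  by apply/imageP; exists (Ordinal kl') => //; apply/val_inj.
(* Double counting bounds the sum of the [l i] over [K] by [D * #|B|]. After raising to the power
   [D.+1], the left side keeps a surplus factor [2 ^ #|B|], which bounds [#|B|]. *)
rewrite -(@leq_exp2r _ _ D.+1) // -expnM => h.
have {}h : (2 ^ (#|B| * D.+1) <= (2 * D.+1) ^ (D.+1 * #|K|) * 2 ^ (D * #|B|))%N.
  apply: leq_trans h _.
  rewrite (big_morph (fun x => x ^ D.+1)%N (fun x y => expnMn x y _) (exp1n _)).
  apply: leq_trans (leq_prod _) _ => [i _|]; first exact: exp_affine_bound.
  rewrite big_split /= prod_nat_const -expnM leq_mul2l; apply/orP; right.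
  rewrite -expn_sum leq_exp2l // mulnC -sum_nat_const /l.
  under eq_bigr do rewrite -sum1_card.
  rewrite (exchange_big_dep (mem B)) /=; last by move=> i b _; rewrite inE => /andP[].
  apply: leq_sum => b bB; apply: leq_trans (rD b bB).
  rewrite -sum1_card; apply: eq_leq; apply: eq_bigl => i.
  by rewrite !inE bB.
rewrite -(@leq_exp2l 2) // -(@leq_pmul2r (2 ^ (D * #|B|))) ?expn_gt0 //.
apply: (@leq_trans ((2 * D.+1) ^ (D.+1 * #|K|) * 2 ^ (D * #|B|))%N).
  by apply: leq_trans h; rewrite -expnD leq_exp2l //; lia.
rewrite leq_mul2r; apply/orP; right.
have -> : (2 * D.+1 ^ 2 * #|K| = 2 * D.+1 * (D.+1 * #|K|))%N by ring.
rewrite [leqRHS]expnM; have [->//|K0] := posnP (D.+1 * #|K|).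
by rewrite leq_exp2r // ltnW // ltn_expl.
Qed.
End Collision.

(** * Adjacency of faces and integral spans *)

Lemma pboolP (P : Prop) : reflect P (pbool P).
Proof. by rewrite /pbool; case: excluded_middle_informative => ?; constructor. Qed.

Section Faces.
Variables (n d : nat).
Implicit Types (s t : {set 'I_n}) (K B Y : {set {set 'I_n}}).

Definition ksets k : {set {set 'I_n}} := [set s : {set 'I_n} | #|s| == k].
Definition cofaces t := [set s in ksets d.+1 | t \subset s].
Definition nbrs t := [set t' in ksets d | (t' != t) && (#|t :|: t'| == d.+1)].
Definition star K := [set s in ksets d.+1 | [exists t in K, t \subset s]].
Definition covered_once K :=
  [set s in ksets d.+1 | #|[set t in K | t \subset s]| == 1%N].

Lemma cofacesE t : t \in ksets d -> cofaces t = [set v |: t | v in ~: t].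
Proof.
rewrite inE => /eqP td; apply/setP => s; rewrite !inE; apply/andP/imsetP.
  move=> [/eqP sd ts].
  have /cards1P[v sv] : #|s :\: t| == 1%N.
    by rewrite cardsD (setIidPr ts) sd td subSnn.
  exists v; first by move: (set11 v); rewrite -sv !inE => /andP[].
  by rewrite -[LHS](setID s t) (setIidPr ts) sv setUC.
move=> [v]; rewrite inE => vt ->; rewrite cardsU1 vt td; split=> //.
exact: subsetUr.
Qed.

Lemma card_cofaces t : t \in ksets d -> #|cofaces t| = (n - d)%N.
Proof.
move=> td; rewrite cofacesE // card_in_imset.
  by rewrite cardsCs setCK card_ord; move: td; rewrite inE => /eqP ->.
move=> u v; rewrite !inE => ut vt E; move: (setU11 u t); rewrite E !inE (negbTE ut).
by rewrite orbF => /eqP.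
Qed.

(** Two distinct [d]-sets have a union of more than [d] elements, so a common coface equals this
    union and is unique. *)
Lemma cofaces_nbrs s t t' :
  t \in ksets d -> t' \in ksets d -> t' != t -> s \in ksets d.+1 ->
  t \subset s -> t' \subset s -> (t' \in nbrs t) /\ s = t :|: t'.
Proof.
rewrite !inE => /eqP td /eqP t'd tt' /eqP sd ts t's.
have Us : t :|: t' \subset s by rewrite subUset ts.
have : (d < #|t :|: t'|)%N.
  rewrite ltnNge; apply: contra tt' => le.
  have E1 : t = t :|: t' by apply/eqP; rewrite eqEcard subsetUl td.
  have E2 : t' = t :|: t' by apply/eqP; rewrite eqEcard subsetUr t'd.
  by rewrite E2 -E1.
move=> ge; have E : s = t :|: t'.
  by apply/eqP; rewrite eq_sym eqEcard Us sd.
by rewrite t'd eqxx tt' -E sd eqxx.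
Qed.

Lemma nbrs_sym t t' : t \in ksets d -> (t' \in nbrs t) -> (t \in nbrs t').
Proof. by rewrite !inE => -> /and3P[_ tt' E]; rewrite eq_sym tt' setUC. Qed.

(** A neighbour replaces one of the [d] vertices of [t] by another vertex. *)
Lemma card_nbrs t : t \in ksets d -> (#|nbrs t| <= d * n)%N.
Proof.
move=> td.
apply: (@leq_trans #|[set p.2 |: (t :\ p.1) | p in setX t [set: 'I_n]]|).
  apply/subset_leq_card/subsetP => t'; rewrite !inE => /and3P[/eqP t'd tt' /eqP U].
  rewrite inE in td; move/eqP: td => td.
  have := cardsUI t t'; rewrite U td t'd => I.
  have /cards1P[u tu] : #|t :\: t'| == 1%N by rewrite cardsD; apply/eqP; lia.
  have /cards1P[v tv] : #|t' :\: t| == 1%N by rewrite cardsD setIC; apply/eqP; lia.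
  apply/imsetP; exists (u, v).
    by rewrite !inE andbT; move: (set11 u); rewrite -tu inE => /andP[].
  rewrite -tv -tu /=; apply/setP => z; rewrite !inE.
  by case: (z \in t); case: (z \in t').
apply: leq_trans (leq_imset_card _ _) _.
by rewrite cardsX cardsT card_ord; move: td; rewrite inE => /eqP ->.
Qed.

(** Each neighbour of [t] in [K] spoils at most one coface of [t]; the remaining cofaces contain no
    other element of [K] and are counted for one [t] only. *)
Lemma card_covered_once K : K \subset ksets d ->
  (\sum_(t in K) (n - d - #|nbrs t :&: K|) <= #|covered_once K|)%N.
Proof.
move=> /subsetP Kd.
pose priv t := cofaces t :\: [set t :|: t' | t' in nbrs t :&: K].
have privP t s : t \in K -> s \in priv t -> [set t' in K | t' \subset s] = [set t].
  move=> tK; rewrite in_setD => /andP[sn]; rewrite inE => /andP[sd ts].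
  apply/setP => t'; rewrite !inE; apply/andP/eqP => [[t'K t's]|->]; last by [].
  apply: contraNeq sn => tt'; apply/imsetP; exists t'.
    rewrite in_setI t'K andbT.
    by case: (@cofaces_nbrs s t t') => //; rewrite ?Kd // inE.
  by case: (@cofaces_nbrs s t t') => //; rewrite ?Kd // inE.
apply: (@leq_trans (\sum_(t in K) #|priv t|)).
  apply: leq_sum => t tK; rewrite -(card_cofaces (Kd _ tK)) cardsD leq_sub2l //.
  apply: leq_trans (subset_leq_card (subsetIr _ _)) (leq_imset_card _ _).
apply: (@leq_trans (\sum_(t in K) #|[set s in covered_once K | t \subset s]|)).
  apply: leq_sum => t tK; apply/subset_leq_card/subsetP => s sp.
  have E := privP _ _ tK sp; move: sp; rewrite in_setD => /andP[_].
  by rewrite inE [in X in _ -> X]inE inE E cards1 eqxx andbT.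
under eq_bigr do rewrite -sum1_card.
rewrite (exchange_big_dep (mem (covered_once K))) /=; last first.
  by move=> t s _; rewrite inE => /andP[].
rewrite -sum1_card; apply: leq_sum => s sK.
move: (sK); rewrite inE => /andP[_ /eqP {2}<-]; rewrite sum1_card; apply: eq_leq.
by apply: eq_card => t; rewrite [in RHS]inE unfold_in /= inE sK.
Qed.

(** Only one term of the coboundary at [s] is nonzero, and it is a value of [f] up to sign. The
    support alone thus determines these faces, whatever the coefficients. *)
Lemma cobd_covered_once (R : comNzRingType) (f : {set 'I_n} -> R) s :
  supp f \subset ksets d -> s \in covered_once (supp f) -> cobd f s != 0.
Proof.
move=> /subsetP fd; rewrite !inE => /andP[/eqP sd /cards1P[t tE]].
have := set11 t; rewrite -tE inE => /andP[tf ts].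
have := fd _ tf; rewrite inE => /eqP td.
have /cards1P[v sv] : #|s :\: t| == 1%N.
  by rewrite cardsD (setIidPr ts) sd td subSnn.
have vs : v \in s by move: (set11 v); rewrite -sv inE => /andP[].
have svt : s :\ v = t by rewrite -sv setDDr setDv set0U (setIidPr ts).
rewrite /cobd (bigD1 v) //= svt big1 => [|u /andP[us uv]].
  rewrite addr0 /inc_sign -signr_odd mulr_sign; rewrite inE in tf.
  by case: ifP; rewrite ?oppr_eq0.
have [->|su] := eqVneq (f (s :\ u)) 0; first by rewrite mulr0.
have : s :\ u \in [set t' in supp f | t' \subset s] by rewrite !inE su subD1set.
rewrite tE inE -svt => /eqP /setP /(_ u); rewrite !inE eqxx us uv.
by [].
Qed.

(* [s] is spanned by [B] after restriction of the boundaries to [K], seen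
   through all the finite cyclic coefficient groups at once. *)
Definition spanned K B s : Prop := forall e (g : {set 'I_n} -> 'Z_e.+2),
  {subset supp g <= K} -> (forall b, b \in B -> cobd g b = 0) -> cobd g s = 0.

Definition unspanned K B : {set {set 'I_n}} :=
  [set s in ksets d.+1 | ~~ pbool (spanned K B s)].

Lemma bd_simplex_support s t : bd (simplex_chain s) t != 0 -> exists2 v, v \in s & t = s :\ v.
Proof.
rewrite ffunE => h.
have [v] : exists v, (v \notin t) && (v |: t == s).
  apply/existsP; apply: contraNT h => /existsPn nv; rewrite big1 // => v vt.
  by move: (nv v); rewrite vt /= ffunE => /negbTE ->; rewrite mulr0.
move=> /andP[vt /eqP <-]; exists v; first exact: setU11.
by rewrite setU1K.
Qed.

Lemma bd_simplex_sign s t : bd (simplex_chain s) t \in [:: 0; 1; -1].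
Proof.
have [->//|h] := eqVneq (bd (simplex_chain s) t) 0.
have [v vs ->] := bd_simplex_support h.
rewrite ffunE (bigD1 v) ?setD11 //= big1 => [|u /andP[us uv]].
  rewrite ffunE setD1K // eqxx mulr1 addr0 -signr_odd.
  by case: odd.
rewrite ffunE; case: eqP => // E; last by rewrite mulr0.
by move: vs; rewrite -E !inE eqxx eq_sym (negbTE uv).
Qed.

(** In a minimal spanning [B] no element is spanned by the others. If [B] were larger, two different
    subsets would have boundary sums agreeing on [K], and an element of just one of them would be
    spanned by the rest. *)
Lemma spanning_subset K Y : Y \subset ksets d.+1 ->
  exists B, [/\ B \subset Y, B \subset star K, (#|B| <= 4 * d.+2 ^ 2 * #|K|)%N &
                forall s, s \in Y -> spanned K B s].
Proof.
move=> Yd.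
have [|B /minsetP[/pboolP[BY BP] Bmin] _] :=
  @minset_exists _ (fun B => pbool (B \subset Y /\ forall s, s \in Y -> spanned K B s)) Y.
  by apply/pboolP; split=> // s sY e g _; apply.
have irr b : b \in B -> ~ spanned K (B :\ b) b.
  move=> bB sb; have /setP/(_ b) : B :\ b = B.
    apply: Bmin; last exact: subD1set.
    apply/pboolP; split=> [|s sY e g gK gB]; first exact: subset_trans (subD1set _ _) BY.
    apply: (BP s sY e g gK) => b' b'B.
    by have [->|b'b] := eqVneq b' b; [exact: sb | apply: gB; rewrite !inE b'b].
  by rewrite !inE bB eqxx.
exists B; split=> //.
  (* An element of [B] without a facet in [K] would be spanned by anything. *)
  apply/subsetP => b bB; rewrite inE (subsetP Yd) ?(subsetP BY) //=.
  apply/negbNE/negP => /existsPn nb; apply: (irr b bB) => e g gK _.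
  rewrite /cobd big1 // => v vb.
  have [->|gv] := eqVneq (g (b :\ v)) 0; first by rewrite mulr0.
  by move: (nb (b :\ v)); rewrite gK ?inE //= subD1set.
rewrite leqNgt; apply/negP => ltB.
(* Boundary entries are 0, 1 or -1, so each face of [K] is indexed twice, once per sign. A [d]-face
   has [d.+1] facets, whence [D = d.+1] in the collision lemma and the constant [4 * d.+2 ^ 2]. *)
pose KK := setX K [set: bool].
pose r (p : {set 'I_n} * bool) := [set b | bd (simplex_chain b) p.1 == (-1) ^+ p.2].
have rB b : b \in B -> (#|[set p in KK | b \in r p]| <= d.+1)%N.
  move=> bB; have := subsetP BY _ bB => /(subsetP Yd); rewrite inE => /eqP <-.
  rewrite -(@card_in_imset _ _ fst) => [|[t1 e1] [t2 e2]]; last first.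
    rewrite !inE /= => /andP[_ /eqP h1] /andP[_ /eqP h2] E; subst t2.
    by move: h2; rewrite h1; case: e1 e2 {h1} => [] [].
  apply: (@leq_trans #|[set b :\ v | v in b]|); last exact: leq_imset_card.
  apply/subset_leq_card/subsetP => _ /imsetP[[t e1] + ->].
  rewrite !inE /= => /andP[_ /eqP h].
  have [|v vb ->] := @bd_simplex_support b t; first by rewrite h signr_eq0.
  exact: imset_f.
have [|B1 [B2 [B1B B2B B12 E]]] := subset_count_collision rB.
  by rewrite cardsX cardsT card_bool; move: ltB; lia.
have sumE e (g : {set 'I_n} -> 'Z_e.+2) : {subset supp g <= K} ->
    \sum_(b in B1) cobd g b = \sum_(b in B2) cobd g b.
  move=> gK; under eq_bigr do rewrite cobd_expand.
  under [RHS]eq_bigr do rewrite cobd_expand.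
  rewrite exchange_big [RHS]exchange_big /=; apply: eq_bigr => t _.
  rewrite -!big_distrr /= -!rmorph_sum.
  have [->|gt] := eqVneq (g t) 0; first by rewrite !mul0r.
  have tK : t \in K by apply: gK; rewrite inE.
  congr (_ * _%:~R).
  have sumB (B' : {set {set 'I_n}}) : \sum_(b in B') bd (simplex_chain b) t =
      #|B' :&: r (t, false)|%:R - #|B' :&: r (t, true)|%:R.
    rewrite -!sum1_card !natr_sum !(big_mkcond (fun b => b \in B' :&: _)) -sumrB.
    rewrite [LHS]big_mkcond /=; apply: eq_bigr => b _; rewrite !inE.
    case: (b \in B') => //=.
    by move: (bd_simplex_sign b t); rewrite !inE => /or3P[] /eqP ->.
  by rewrite !sumB !E // !inE tK.
wlog [b bB1 bB2] : B1 B2 B1B B2B B12 E sumE / exists2 b, b \in B1 & b \notin B2.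
  move=> W; have [|] := boolP (B1 \subset B2); last first.
    by move=> /subsetPn h; apply: (W B1 B2).
  have [|/subsetPn h _] := boolP (B2 \subset B1).
    by move=> h1 h2; case/eqP: B12; apply/eqP; rewrite eqEsubset h2.
  apply: (W B2 B1) => //; first by rewrite eq_sym.
    by move=> i iK; rewrite E.
  by move=> e g gK; rewrite sumE.
apply: (irr b (subsetP B1B _ bB1)) => e g gK gB.
have := sumE e g gK; rewrite (bigD1 b) //= big1 ?addr0 => [->|b' /andP[b'1 b'b]].
  rewrite big1 // => b' b'2; apply: gB; rewrite !inE (subsetP B2B) // andbT.
  by apply: contraNneq bB2 => <-.
by apply: gB; rewrite !inE b'b (subsetP B1B).
Qed.

End Faces.

(** * The deterministic statement *)

Section Deterministic.
Variables (n d kappa : nat).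
Hypothesis d0 : (0 < d)%N.
Implicit Types (s t : {set 'I_n}) (K B Y : {set {set 'I_n}}).

(** Requiring a neighbour in [K] for each element limits the number of such [K], by
    [half_dominating]. *)
Definition small_bad Y : bool := [exists K : {set {set 'I_n}},
  [&& K \subset ksets n d, K != set0, (#|K| <= kappa)%N,
      [forall t in K, nbrs d t :&: K != set0] & [disjoint covered_once d K & Y]]].

(** [B] plays the role of a spanning subset of [Y]. The unspanned faces depend on [K] and [B] only,
    not on a modulus or a cochain, so for fixed [K] and [B] the event has an explicit
    probability. *)
Definition large_bad Y : bool := [exists K : {set {set 'I_n}},
  [&& K \subset ksets n d, (kappa < #|K|)%N &
    [exists B : {set {set 'I_n}},
      [&& B \subset star d K, (#|B| <= 4 * d.+2 ^ 2 * #|K|)%N, B \subset Y,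
          covered_once d K \subset unspanned d K B,
          (n * #|K| <= d.+1 * #|unspanned d K B|)%N &
          [disjoint unspanned d K B & Y]]]]].

Definition has_isolated Y : bool := [exists t in ksets n d, [disjoint cofaces d t & Y]].

Definition good Y := [&& ~~ small_bad Y, ~~ large_bad Y & has_isolated Y].

Lemma minimal_representative e (f : {set 'I_n} -> 'Z_e.+2) :
  exists h : {set 'I_n} -> 'Z_e.+2, (forall t, h t != 0 -> #|t| = d.-1) /\
   forall h', (forall t, h' t != 0 -> #|t| = d.-1) ->
   (#|supp (fun t => f t - cobd h t)%R| <= #|supp (fun t => f t - cobd h' t)%R|)%N.
Proof.
pose P (h : {ffun {set 'I_n} -> 'Z_e.+2}) := [forall t : {set 'I_n}, (h t != 0) ==> (#|t| == d.-1)].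
have P0 : P [ffun=> 0] by apply/forallP => t; rewrite ffunE eqxx.
case: (arg_minnP (fun h : {ffun {set 'I_n} -> 'Z_e.+2} =>
  #|supp (fun t => f t - cobd h t)|) P0) => h Ph hmin.
exists h; split=> [t ht|h' Ph'].
  by move/forallP/(_ t): Ph; rewrite ht => /eqP.
have -> : #|supp (fun t => f t - cobd h' t)| =
    #|supp (fun t => f t - cobd [ffun t => h' t] t)|.
  by apply: eq_card => t; rewrite !inE -(eq_cobd (ffunE h')).
by apply: hmin; apply/forallP => t; rewrite ffunE; apply/implyP => /Ph'/eqP.
Qed.

(** [Y] is the sampled set and [Yd] any larger complex. The support [K] of a minimal cocycle must be
    small, since [Y] is not [large_bad], and without adjacent elements, since [Y] is not
    [small_bad]; then [niso] makes it empty. *)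
Lemma good_vanish Y (Yd : seq {set 'I_n}) :
  ~~ small_bad Y -> ~~ large_bad Y -> {subset Y <= Yd} ->
  (forall s, s \in Y -> is_face d s) -> (forall s, s \in Yd -> is_face d s) ->
  no_isolated d Yd -> Hvanish d Yd.
Proof.
move=> nsmall nlarge YYd Yface Ydface niso z zd bz.
apply: NNPP => nc.
have [c cYd cz|e [f0 [f0Y f0z]]] := @chain_dual n (fun s => s \in Yd) z.
  apply: nc; exists c; split=> // s /cYd sYd; rewrite sYd; exact: Ydface.
(* Only the values on [d]-sets matter for [z] and for the coboundary on [Yd]; truncation makes the
   minimal support argument available. *)
pose f1 t := if #|t| == d then f0 t else 0.
have [h [hd hmin]] := minimal_representative f1.
pose f t := f1 t - cobd h t.
have f1d t : f1 t != 0 -> #|t| = d by rewrite /f1; case: ifP => [/eqP|]; rewrite ?eqxx.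
have fd t : f t != 0 -> #|t| = d.
  rewrite /f; have [->|/f1d//] := eqVneq (f1 t) 0.
  by rewrite sub0r oppr_eq0 => /(cobd_card_support hd); rewrite prednK.
have fY s : s \in Yd -> cobd f s = 0.
  move=> sY; rewrite cobdB cobd_cobd subr0 -(f0Y s sY).
  have := Ydface s sY; rewrite /is_face => /eqP sd.
  apply: eq_bigr => v vs; rewrite /f1 ifT //.
  by move: sd; rewrite (cardsD1 v) vs add1n => -[->].
have fz : \sum_t f t * (z t)%:~R != 0.
  have -> : \sum_t f t * (z t)%:~R = \sum_t f0 t * (z t)%:~R :> 'Z_e.+2; last by [].
  under eq_bigr do rewrite mulrBl.
  (* A coboundary pairs to zero with the cycle [z]. *)
  rewrite sumrB cobd_bd_adjoint bz [X in _ - X]big1 ?subr0 => [|t _]; last first.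
    by rewrite ffunE mulr0.
  apply: eq_bigr => t _; rewrite /f1; case: ifPn => // td.
  have [->|/zd] := eqVneq (z t) 0; first by rewrite !mulr0.
  by rewrite /is_face prednK // (negbTE td).
have suppd : supp f \subset ksets n d.
  by apply/subsetP => t; rewrite !inE => /fd ->.
have minf : (n * #|supp f| <= d.+1 * #|supp (cobd f)|)%N.
  apply: minimal_supp_le => // h' h'd.
  apply: leq_trans (hmin (fun t => h t + h' t) _) _.
    by move=> t; have [->|/hd//] := eqVneq (h t) 0; rewrite add0r => /h'd.
  apply: eq_leq; apply: eq_card => t; rewrite !inE /f.
  have -> : cobd (fun t => h t + h' t) t = cobd h t + cobd h' t.
    by rewrite /cobd -big_split; apply: eq_bigr => v _; rewrite mulrDr.
  by rewrite opprD addrA.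
set K := supp f in suppd minf.
have coverN s : s \in Yd -> s \notin covered_once d K.
  move=> sY; apply/negP => /(cobd_covered_once suppd).
  by rewrite fY ?eqxx.
have suppdf s : s \in supp (cobd f) -> s \in ksets n d.+1.
  by rewrite !inE => /(cobd_card_support fd) ->.
have smallK : (#|K| <= kappa)%N.
  rewrite leqNgt; apply: contra nlarge => largeK.
  have Yd1 : Y \subset ksets n d.+1 by apply/subsetP => s /Yface; rewrite inE.
  have [B [BY BK Bcard Bspan]] := spanning_subset K Yd1.
  have SS : supp (cobd f) \subset unspanned d K B.
    apply/subsetP => s sS; rewrite inE suppdf //=; apply/negP => /pboolP sp.
    move: sS; rewrite inE (sp e f) ?eqxx // => b bB.
    by apply: fY; apply: YYd; apply: (subsetP BY).
  apply/existsP; exists K; rewrite suppd largeK /=.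
  apply/existsP; exists B; rewrite BK Bcard BY /=; apply/and3P; split.
  - apply: subset_trans SS; apply/subsetP => s sc; rewrite inE.
    exact: cobd_covered_once sc.
  - by apply: leq_trans minf _; rewrite leq_mul2l subset_leq_card ?orbT.
  - rewrite disjoint_sym disjoints_subset; apply/subsetP => s sY; rewrite !inE negb_and negbK.
    by apply/orP; right; apply/pboolP; apply: Bspan.
have adjK s t t' : t \in K -> t' \in K -> t' != t -> is_face d s ->
    t \subset s -> t' \subset s -> t' \in nbrs d t.
  move=> /(subsetP suppd) td /(subsetP suppd) t'd t't sd ts t's.
  by case: (@cofaces_nbrs n d s t t') => //; rewrite inE.
(* Elements of [K] without neighbours in [K] are discarded. Neighbours in [K] of an element of [K2]
   lie again in [K2], so a face covered once by [K2] is covered once by [K]. *)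
pose K2 := [set t in K | nbrs d t :&: K != set0].
have K2d : K2 \subset ksets n d.
  by apply: subset_trans suppd; apply/subsetP => t; rewrite inE => /andP[].
have K20 : K2 = set0.
  apply/eqP; apply: contraNT nsmall => nK2; apply/existsP; exists K2.
  rewrite K2d nK2 /=; apply/and3P; split.
  - apply: leq_trans smallK; apply/subset_leq_card/subsetP => t.
    by rewrite inE => /andP[].
  - apply/forallP => t; apply/implyP; rewrite inE => /andP[tK /set0Pn[t']].
    rewrite inE => /andP[t'n t'K]; apply/set0Pn; exists t'; rewrite in_setI t'n inE t'K.
    apply/set0Pn; exists t; rewrite in_setI tK andbT.
    by apply: nbrs_sym => //; apply: (subsetP suppd).
  rewrite disjoint_sym disjoints_subset; apply/subsetP => s sY; rewrite inE.
  apply: contra (coverN s (YYd s sY)); rewrite !inE => /andP[sd /cards1P[t tE]].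
  rewrite sd; apply/cards1P; exists t; rewrite -tE; apply/setP => t'; rewrite !inE.
  apply/andP/andP => [[t'K t's]|[/andP[t'K _] t's]]; split=> //; rewrite t'K /=.
  have := set11 t; rewrite -tE inE => /andP[]; rewrite inE => /andP[tK _] ts.
  have [t't|t't] := eqVneq t' t.
    by have := set11 t; rewrite t't -tE 2!inE => /andP[/andP[]].
  apply/set0Pn; exists t; rewrite in_setI tK andbT.
  by apply: (adjK s) => //; rewrite ?inE // eq_sym.
(* No two elements of [K] are adjacent now, so a face of [Yd] containing an element of [K] would be
   covered once. *)
have K0 : K = set0.
  apply/eqP; apply/negbNE/negP => /set0Pn[t tK].
  have td := subsetP suppd _ tK.
  have [|s sY ts] := niso t; first by move: td; rewrite inE /is_face prednK.
  have := coverN s sY; rewrite inE; rewrite inE [#|s| == _]Ydface //= => /negP; apply.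
  apply/cards1P; exists t; apply/setP => t'; rewrite !inE.
  apply/andP/eqP => [[t'K t's]|->]; last by rewrite ts; move: tK; rewrite inE.
  apply/eqP; apply: contraT => t't.
  have : t \in K2.
    rewrite inE; apply/andP; split=> //; apply/set0Pn; exists t'.
    by rewrite in_setI (adjK s) ?inE //; [move: tK; rewrite inE | apply: Ydface].
  by rewrite K20 inE.
move: fz; rewrite big1 ?eqxx // => t _.
have [->|ft] := eqVneq (f t) 0; first by rewrite mul0r.
by move/setP/(_ t): K0; rewrite !inE ft.
Qed.

(** For [v] outside [t], the boundary of the simplex [v |: t] is a cycle with coefficient 1 or -1 at
    [t], whereas boundaries of chains on [Yd] vanish at [t]. *)
Lemma isolated_not_vanish (Yd : seq {set 'I_n}) t : (d < n)%N ->
  t \in ksets n d -> (forall s, s \in Yd -> ~~ (t \subset s)) -> ~ Hvanish d Yd.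
Proof.
move=> dn; rewrite inE => /eqP td iso vanish.
have [v vt] : exists v, v \notin t.
  apply/existsP; apply/negbNE/negP => /existsPn h.
  move: dn; rewrite -td ltnNge -[n in (n <= _)%N]card_ord -cardsT.
  by rewrite subset_leq_card //; apply/subsetP => v _; have := h v; rewrite negbK.
have [t' h|//|c [cY cz]] := vanish (bd (simplex_chain (v |: t))).
- have [u us ->] := bd_simplex_support h.
  by move: (cardsD1 u (v |: t)); rewrite us cardsU1 vt td /= !add1n /is_face prednK // => -[<-].
- exact: bd_bd.
have : bd c t = 0.
  rewrite ffunE big1 // => u ut.
  have [->|/cY/andP[/iso]] := eqVneq (c (u |: t)) 0; first by rewrite mulr0.
  by rewrite subsetUr.
rewrite cz ffunE (bigD1 v) //= ffunE eqxx mulr1 big1 ?addr0.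
  by move/eqP; rewrite signr_eq0.
move=> u /andP[ut uv]; rewrite ffunE; case: eqP => [E|]; last by rewrite mulr0.
by have := setU11 u t; rewrite E !inE (negbTE uv) (negbTE ut).
Qed.

(** Let [T] be the time at which the last isolated face gets covered. Since [t0] is isolated at time
    [m], [m < T], and [good_vanish] applies at [T]; before [T] an isolated face prevents
    vanishing. *)
Lemma good_coincide (w : (Nfaces n d).-tuple {set 'I_n}) m : (d < n)%N ->
  trajectory w -> (m <= Nfaces n d)%N ->
  good [set s in take m w] -> hitting_times_coincide w.
Proof.
move=> dn /andP[uw /allP wf] mN /and3P[nsmall nlarge /existsP[t0 /andP[t0d t0iso]]].
have wall s : is_face d s -> s \in w.
  move=> sd.
  have : [set s in w] = ksets n d.+1.
    apply/eqP; rewrite eqEcard; apply/andP; split.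
      by apply/subsetP => s'; rewrite !inE => /wf.
    by rewrite card_draws card_ord cardsE (card_uniqP uw) size_tuple.
  by move/setP/(_ s); rewrite !inE [#|s| == _]sd.
have ex : exists k, (k <= Nfaces n d)%N && pbool (no_isolated d (take k w)).
  exists (Nfaces n d); rewrite leqnn; apply/pboolP => t; rewrite /is_face prednK // => td.
  have : #|cofaces d t| != 0%N by rewrite card_cofaces ?inE // -lt0n subn_gt0.
  rewrite cards_eq0 => /set0Pn[s]; rewrite !inE => /andP[sd ts]; exists s => //.
  by rewrite take_oversize ?size_tuple //; apply: wall.
case: (ex_minnP ex) => T /andP[TN /pboolP niso] Tmin.
have mT : (m < T)%N.
  rewrite ltnNge; apply/negP => Tm; move: t0iso; apply/negP.
  have [|s sY ts] := niso t0; first by move: t0d; rewrite inE /is_face prednK.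
  have sm : s \in take m w.
    by rewrite -(subnKC Tm) takeD mem_cat sY.
  apply/pred0Pn; exists s; rewrite /= !inE sm ts !andbT.
  by apply: wf; apply: mem_take sY.
have before k : (k < T)%N -> ~ no_isolated d (take k w).
  move=> kT kiso; have : (T <= k)%N; last by rewrite leqNgt kT.
  by apply: Tmin; rewrite (ltnW (leq_trans kT TN)); apply/pboolP.
exists T; split; split=> //; split=> //.
  apply: (@good_vanish [set s in take m w]) => // s; rewrite ?inE.
  - by rewrite -(subnKC (ltnW mT)) takeD mem_cat => ->.
  - by move/mem_take/wf.
  - by move/mem_take/wf.
move=> k kT vanish; apply: (before k kT) => t td.
apply: NNPP => nex.
apply: (@isolated_not_vanish (take k w) t) vanish => //.
  by move: td; rewrite inE /is_face prednK.
by move=> s sY; apply/negP => ts; apply: nex; exists s.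
Qed.

End Deterministic.

(** * Binomial random sets *)

Lemma sum_subsets_card (R : comNzRingType) (T : finType) (W : {set T}) (a b : R) :
  \sum_(Z : {set T} | Z \subset W) a ^+ #|Z| * b ^+ (#|W| - #|Z|) = (a + b) ^+ #|W|.
Proof.
rewrite addrC exprDn (partition_big (fun Z : {set T} => inord #|Z| : 'I_#|W|.+1) xpredT) //=.
apply: eq_bigr => i _.
have E (Z : {set T}) : (Z \subset W) && (inord #|Z| == i) = (Z \subset W) && (#|Z| == i).
  case: (boolP (Z \subset W)) => //= /subset_leq_card ZW.
  by rewrite -val_eqE /= inordK.
rewrite -(cards_draws W i) (eq_bigl _ _ E) -sumr_const big_set /=.
apply: eq_bigr => Z /andP[_ /eqP ->]; exact: mulrC.
Qed.

Section Binomial.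
Variables (R : numFieldType) (T : finType) (U : {set T}) (p : R).
Hypotheses (p0 : 0 <= p) (p1 : p <= 1).
Implicit Types (A S Y : {set T}) (E F : pred {set T}).

(** The law of a random subset of [U] containing each element independently with probability [p]. *)
Definition rweight Y : R := p ^+ #|Y| * (1 - p) ^+ (#|U| - #|Y|).

Definition rprob E : R := \sum_(Y : {set T} | (Y \subset U) && E Y) rweight Y.

Lemma rweight_ge0 Y : 0 <= rweight Y.
Proof. by rewrite mulr_ge0 ?exprn_ge0 ?subr_ge0. Qed.

Lemma rprob_ge0 E : 0 <= rprob E.
Proof. by apply: sumr_ge0 => Y _; exact: rweight_ge0. Qed.

Lemma rprob_mkcond E :
  rprob E = \sum_(Y : {set T} | Y \subset U) rweight Y * (E Y)%:R.
Proof.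
rewrite /rprob big_mkcondr; apply: eq_bigr => Y _.
by case: (E Y); rewrite ?mulr1 ?mulr0.
Qed.

(** Membership outside [A :|: S] is free, and its weights sum to 1 by the binomial theorem. *)
Lemma rprob_pattern A S : A \subset U -> S \subset U -> [disjoint S & A] ->
  rprob (fun Y => (A \subset Y) && [disjoint S & Y]) = p ^+ #|A| * (1 - p) ^+ #|S|.
Proof.
move=> AU SU SA; pose W := U :\: (A :|: S).
have AW : [disjoint A & W].
  by rewrite -setI_eq0; apply/eqP/setP => z; rewrite !inE; case: (z \in A).
have cU : #|U| = (#|A| + #|S| + #|W|)%N.
  have US : A :|: S \subset U by rewrite subUset AU.
  rewrite -(cardsID (A :|: S) U) (setIidPr US) cardsU.
  by move: SA; rewrite -setI_eq0 setIC => /eqP ->; rewrite cards0 subn0.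
have sum1 : \sum_(Z : {set T} | Z \subset W) p ^+ #|Z| * (1 - p) ^+ (#|W| - #|Z|) = 1.
  by rewrite sum_subsets_card (_ : p + (1 - p) = 1) ?expr1n //; ring.
rewrite -[RHS]mulr1 -[X in _ * X]sum1 big_distrr /=.
rewrite /rprob (reindex_onto (fun Z => A :|: Z) (fun Y => Y :\: A)) /=; last first.
  by move=> Y /and3P[_ AY _]; rewrite -[RHS](setID Y A) (setIidPr AY).
have disjE (B C : {set T}) : [disjoint B & C] = (B \subset ~: C).
  by rewrite disjoints_subset.
have PE (Z : {set T}) : [&& A :|: Z \subset U, A \subset A :|: Z & [disjoint S & A :|: Z]] &&
    ((A :|: Z) :\: A == Z) = (Z \subset W).
  rewrite subsetUl !disjE /= subUset AU /=.
  apply/andP/idP => [[/andP[ZU SZ] /eqP ZE]|ZW].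
    apply/subsetP => z zZ; rewrite !inE (subsetP ZU) // andbT negb_or.
    apply/andP; split; first by move: zZ; rewrite -ZE inE => /andP[].
    by apply/negP => /(subsetP SZ); rewrite !inE zZ orbT.
  have ZA z : z \in Z -> (z \notin A) && (z \notin S) && (z \in U).
    by move/(subsetP ZW); rewrite !inE negb_or.
  split; last first.
    apply/eqP/setP => z; rewrite !inE.
    by case zZ: (z \in Z); rewrite ?orbT ?orbF; [case/andP: (ZA _ zZ) => /andP[->] | case: (z \in A)].
  apply/andP; split; first by apply/subsetP => z /ZA /andP[].
  apply/subsetP => z zS; rewrite !inE negb_or; apply/andP; split.
    by rewrite (disjointFr SA zS).
  by apply/negP => /ZA /andP[/andP[_]]; rewrite zS.
rewrite (eq_bigl _ _ PE). apply: eq_bigr => Z ZW.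
have AZ : A :&: Z = set0.
  by apply/eqP; rewrite setI_eq0; apply: disjointWr AW.
have := subset_leq_card ZW; rewrite /rweight cardsU AZ cards0 subn0 cU => cZW.
rewrite (_ : (#|A| + #|S| + #|W| - (#|A| + #|Z|) = #|S| + (#|W| - #|Z|))%N); last by lia.
by rewrite !exprD mulrACA.
Qed.

Lemma rprob_le E F : (forall Y, Y \subset U -> E Y -> F Y) -> rprob E <= rprob F.
Proof.
move=> EF; rewrite !rprob_mkcond; apply: ler_sum => Y YU.
apply: ler_wpM2l; first exact: rweight_ge0.
by case EY: (E Y); rewrite ?ler0n // (EF Y YU EY).
Qed.

Lemma rprob_union_bound (I : finType) (P : pred I) (E : I -> pred {set T}) :
  rprob (fun Y => [exists i, P i && E i Y]) <= \sum_(i | P i) rprob (E i).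
Proof.
under [leRHS]eq_bigr do rewrite rprob_mkcond.
rewrite exchange_big rprob_mkcond; apply: ler_sum => Y _ /=.
rewrite -big_distrr /=; apply: ler_wpM2l; first exact: rweight_ge0.
case: existsP => [[i /andP[Pi Ei]]|_]; last by apply: sumr_ge0 => i _.
rewrite (bigD1 i) //= Ei -[leLHS]addr0; apply: lerD => //.
by apply: sumr_ge0.
Qed.

Lemma rprob_orb E F : rprob (fun Y => E Y || F Y) <= rprob E + rprob F.
Proof.
rewrite !rprob_mkcond -big_split; apply: ler_sum => Y _ /=.
rewrite -mulrDr; apply: ler_wpM2l; first exact: rweight_ge0.
by case: (E Y); case: (F Y); rewrite ?addr0 ?add0r ?lerDl ?ler01 ?lexx.
Qed.

Lemma rprob_disjoint S : S \subset U ->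
  rprob (fun Y => [disjoint S & Y]) = (1 - p) ^+ #|S|.
Proof.
move=> SU; have := @rprob_pattern set0 S; rewrite sub0set cards0 mul1r => <- //.
  by rewrite /rprob; apply: eq_bigl => Y; rewrite sub0set.
by rewrite -setI_eq0 setI0.
Qed.

Lemma sum_rweight : \sum_(Y : {set T} | Y \subset U) rweight Y = 1.
Proof.
rewrite -[RHS](expr0 (1 - p)) -(cards0 T) -rprob_disjoint ?sub0set // /rprob.
by apply: eq_bigl => Y; rewrite -setI_eq0 set0I eqxx andbT.
Qed.

(* Second moment method for the number of blocks [c i] missed by [Y]. *)
Lemma rprob_all_blocks_hit (I : finType) (J : {set I}) (c : I -> {set T})
    (nb : I -> {set I}) (a D : nat) :
  (forall i, i \in J -> c i \subset U /\ #|c i| = a) ->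
  (forall i, i \in J -> (#|nb i| <= D)%N) ->
  (forall i j, i \in J -> j \in J -> j != i -> (#|c i :&: c j| <= (j \in nb i))%N) ->
  rprob (fun Y => ~~ [exists i in J, [disjoint c i & Y]])
     * (#|J|%:R * (1 - p) ^+ a) ^+ 2
  <= #|J|%:R * (1 - p) ^+ a + #|J|%:R * D%:R * (1 - p) ^+ (2 * a).-1.
Proof.
move=> cU nbD cI; set y := 1 - p.
have y0 : 0 <= y by rewrite subr_ge0.
have y1 : y <= 1 by rewrite gerBl.
pose X (Y : {set T}) : R := \sum_(i in J) [disjoint c i & Y]%:R.
set mu := #|J|%:R * y ^+ a.
have EX : \sum_(Y : {set T} | Y \subset U) rweight Y * X Y = mu.
  under eq_bigr do rewrite big_distrr /=.
  rewrite exchange_big /= /mu -sumr_const big_distrl /=; apply: eq_bigr => i iJ.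
  by have [ciU ca] := cU i iJ; rewrite mul1r -rprob_mkcond rprob_disjoint // ca.
have EX2 : \sum_(Y : {set T} | Y \subset U) rweight Y * X Y ^+ 2 <=
    mu ^+ 2 + (mu + #|J|%:R * D%:R * y ^+ (2 * a).-1).
  have -> : \sum_(Y : {set T} | Y \subset U) rweight Y * X Y ^+ 2 =
      \sum_(i in J) \sum_(j in J) y ^+ #|c i :|: c j|.
    under eq_bigr do rewrite expr2 /X big_distrlr big_distrr /=.
    rewrite exchange_big; apply: eq_bigr => i iJ /=.
    under eq_bigr do rewrite big_distrr /=.
    rewrite exchange_big; apply: eq_bigr => j jJ /=.
    rewrite -rprob_disjoint; last by rewrite subUset (cU i iJ).1 (cU j jJ).1.
    rewrite rprob_mkcond; apply: eq_bigr => Y _; congr (_ * _).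
    rewrite -natrM mulnb; congr (_ %:R); congr (nat_of_bool _).
    by rewrite -!setI_eq0 setIUl setU_eq0.
  have -> : mu ^+ 2 + (mu + #|J|%:R * D%:R * y ^+ (2 * a).-1) =
      \sum_(i in J) (#|J|%:R * y ^+ (2 * a) + (y ^+ a + D%:R * y ^+ (2 * a).-1)).
    rewrite sumr_const /mu -[RHS]mulr_natl mul2n -addnn exprD; ring.
  apply: ler_sum => i iJ; have [ciU ca] := cU i iJ.
  rewrite (bigD1 i) //= setUid ca addrCA lerD2l.
  have -> : #|J|%:R * y ^+ (2 * a) + D%:R * y ^+ (2 * a).-1 =
     (\sum_(j in J) y ^+ (2 * a)) + D%:R * y ^+ (2 * a).-1.
    by rewrite sumr_const mulr_natl.
  apply: le_trans (_ : \sum_(j in J) (y ^+ (2 * a) +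
      (j \in nb i)%:R * y ^+ (2 * a).-1) <= _); last first.
    rewrite big_split lerD2l -big_distrl ler_wpM2r ?exprn_ge0 // -natr_sum ler_nat.
    apply: leq_trans (nbD i iJ); rewrite -sum1_card big_mkcond [leqRHS]big_mkcond /=.
    by apply: leq_sum => j _; case: (j \in J); case: (j \in nb i).
  rewrite [leRHS](bigD1 i) //= -[leLHS]add0r; apply: lerD.
    by rewrite addr_ge0 ?mulr_ge0 ?exprn_ge0.
  apply: ler_sum => j /andP[jJ ji]; have [cjU cb] := cU j jJ.
  (* The union of the two blocks has at least [(2 * a).-1] elements, and exactly [2 * a] unless [j]
     is in [nb i]. *)
  have := cI i j iJ jJ ji; rewrite cardsU ca cb addnn -mul2n.
  case: (j \in nb i) => [le1|].
    rewrite mul1r -[leLHS]add0r lerD ?exprn_ge0 //.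
    by apply: ler_wiXn2l => //; lia.
  by rewrite leqn0 => /eqP ->; rewrite subn0 mul0r addr0.
have VX : \sum_(Y : {set T} | Y \subset U) rweight Y * (X Y - mu) ^+ 2 <=
    mu + #|J|%:R * D%:R * y ^+ (2 * a).-1.
  have -> : \sum_(Y : {set T} | Y \subset U) rweight Y * (X Y - mu) ^+ 2 =
     \sum_(Y : {set T} | Y \subset U) rweight Y * X Y ^+ 2
      - 2 * mu * (\sum_(Y : {set T} | Y \subset U) rweight Y * X Y)
      + mu ^+ 2 * (\sum_(Y : {set T} | Y \subset U) rweight Y).
    rewrite !big_distrr -sumrB -big_split; apply: eq_bigr => Y _ /=; ring.
  rewrite EX sum_rweight.
  rewrite -(lerD2l (mu ^+ 2)); apply: le_trans EX2.
  by rewrite le_eqVlt; apply/orP; left; apply/eqP; ring.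
(* Chebyshev's argument: when every block is hit, [X Y = 0] and the squared deviation is
   [mu ^+ 2]. *)
apply: le_trans VX; rewrite rprob_mkcond big_distrl /=; apply: ler_sum => Y _.
rewrite -mulrA; apply: ler_wpM2l; first exact: rweight_ge0.
have mur : 0 <= mu by rewrite mulr_ge0 ?exprn_ge0.
have XR : X Y \is Num.real by rewrite realE sumr_ge0 // => i _.
case: existsP => [_|nex]; rewrite ?mul0r.
  by rewrite real_exprn_even_ge0 // realB // realE mur.
rewrite mul1r /X big1 ?sub0r ?sqrrN // => i iJ.
by case disj: [disjoint _ & _] => //; case: nex; exists i; rewrite iJ.
Qed.
End Binomial.

(** * The Linial-Meshulam process at a binomial time *)

Section Process.
Variables (n d : nat).
Local Notation N := (Nfaces n d).
Local Notation U := (ksets n d.+1).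

Lemma card_ksets k : #|ksets n k| = 'C(n, k).
Proof. by rewrite card_draws card_ord. Qed.

Lemma trajectoryE (w : N.-tuple {set 'I_n}) :
  trajectory w = (w \in [set t : N.-tuple {set 'I_n} | all (mem U) t & uniq t]).
Proof.
rewrite inE /trajectory andbC; congr (_ && _).
by apply: eq_all => s; rewrite /is_face /= inE.
Qed.

Lemma card_trajectory : #|[pred w : N.-tuple {set 'I_n} | trajectory w]| = N`!.
Proof.
rewrite (eq_card trajectoryE) card_uniq_tuples -ffactnn; congr (_ ^_ _).
exact: card_ksets.
Qed.

(** At step [k] exactly [N - k] faces are left, so all trajectories are equally likely. *)
Lemma traj_weightE (w : N.-tuple {set 'I_n}) :
  trajectory w -> traj_weight w = (N`!%:R)^-1.
Proof.
move=> /andP[uw /allP wf].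
rewrite /traj_weight prodfV -natr_prod -ffactnn ffact_prod; congr (_%:R^-1).
apply: eq_bigr => k _.
have -> : [set s : {set 'I_n} | is_face d s & s \notin take k w] =
          U :\: [set s in take k w].
  by apply/setP => s; rewrite !inE andbC.
rewrite cardsD (setIidPr _) ?card_ksets; last first.
  by apply/subsetP => s; rewrite !inE => /mem_take /wf.
congr (_ - _)%N; rewrite cardsE.
by rewrite (card_uniqP (take_uniq _ uw)) size_takel // size_tuple ltnW.
Qed.

(** Cutting [w] after [#|Y|] steps gives an ordering of [Y] and one of the remaining faces, which
    together determine [w]. *)
Lemma card_trajectory_prefix (Y : {set {set 'I_n}}) : Y \subset U ->
  (#|[pred w : N.-tuple {set 'I_n} | trajectory w & [set s in take #|Y| w] == Y]|
   <= #|Y|`! * (N - #|Y|)`!)%N.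
Proof.
move=> YU; set m := #|Y|.
have mN : (m <= N)%N by rewrite -[N]card_ksets subset_leq_card.
pose A1 := [set t : m.-tuple {set 'I_n} | all (mem Y) t & uniq t].
pose A2 := [set t : (N - m).-tuple {set 'I_n} | all (mem (U :\: Y)) t & uniq t].
have -> : (m`! * (N - m)`! = #|setX A1 A2|)%N.
  rewrite cardsX !card_uniq_tuples ffactnn cardsD (setIidPr YU) card_ksets.
  by rewrite ffactnn.
pose h (w : N.-tuple {set 'I_n}) := (insubd (nseq_tuple m set0) (take m w),
  insubd (nseq_tuple (N - m) set0) (drop m w)).
have s1 (w : N.-tuple {set 'I_n}) : size (take m w) == m.
  by rewrite size_takel ?size_tuple.
have s2 (w : N.-tuple {set 'I_n}) : size (drop m w) == (N - m)%N.
  by rewrite size_drop size_tuple.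
rewrite -(@card_in_imset _ _ h) => [|w1 w2 _ _ [/(congr1 val) e1 /(congr1 val) e2]]; last first.
  rewrite !val_insubd !s1 in e1; rewrite !val_insubd !s2 in e2.
  by apply: val_inj; rewrite /= -(cat_take_drop m w1) e1 e2 cat_take_drop.
apply/subset_leq_card/subsetP => _ /imsetP[w + ->]; rewrite inE => /andP[/andP[uw /allP wf] /eqP wY].
have wYE s : (s \in take m w) = (s \in Y) by rewrite -wY inE.
rewrite in_setX !inE !val_insubd s1 s2 /= take_uniq ?drop_uniq // !andbT.
apply/andP; split; apply/allP => s sw; rewrite /= -?wYE // !inE -wYE.
have := uw; rewrite -{1}(cat_take_drop m w) cat_uniq => /and3P[_ /hasPn nh _].
by rewrite (nh s sw) /=; apply: wf; apply: mem_drop sw.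
Qed.

Section Transfer.
Variables (R : numFieldType) (p : R).
Hypotheses (p0 : 0 <= p) (p1 : p <= 1).

Lemma LMprob_le1 (E : N.-tuple {set 'I_n} -> Prop) : LMprob E <= 1.
Proof.
rewrite /LMprob; apply: (@le_trans _ _ (\sum_(w | trajectory w) (N`!%:R)^-1)).
  apply: ler_sum => w tw; rewrite traj_weightE // ler_piMr ?invr_ge0 ?ler0n //.
  by case: pbool.
by rewrite sumr_const card_trajectory -(mulr_natl _^-1) mulfV // pnatr_eq0 -lt0n fact_gt0.
Qed.

(* The binomial random set is the process stopped at an independent binomial time. *)
Lemma LMprob_transfer (E : N.-tuple {set 'I_n} -> Prop) (F : pred {set {set 'I_n}}) :
  (forall w m, trajectory w -> (m <= N)%N -> ~~ F [set s in take m w] -> E w) ->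
  ratr (1 - LMprob E) <= rprob U p F.
Proof.
move=> EF.
have N0 : N`!%:R != 0 :> R by rewrite pnatr_eq0 -lt0n fact_gt0.
have -> : ratr (1 - LMprob E) =
    \sum_(w : N.-tuple {set 'I_n} | trajectory w) (N`!%:R)^-1 * (~~ pbool (E w))%:R :> R.
  have -> : 1 - LMprob E =
    \sum_(w : N.-tuple {set 'I_n} | trajectory w) (N`!%:R)^-1 * (~~ pbool (E w))%:R.
    have S1 : 1 = \sum_(w : N.-tuple {set 'I_n} | trajectory w) (N`!%:R)^-1 :> rat.
      by rewrite sumr_const card_trajectory -(mulr_natl _^-1) mulfV // pnatr_eq0 -lt0n fact_gt0.
    rewrite /LMprob [X in X - _]S1 -sumrB; apply: eq_bigr => w tw; rewrite traj_weightE //.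
    by case: pbool; rewrite ?mulr1 ?mulr0 ?subrr ?subr0.
  rewrite rmorph_sum; apply: eq_bigr => w _.
  by rewrite rmorphM fmorphV !rmorph_nat.
have cU : #|U| = N := card_ksets _.
pose b m : R := p ^+ m * (1 - p) ^+ (N - m).
have bge m : 0 <= b m by rewrite mulr_ge0 ?exprn_ge0 ?subr_ge0.
have sum1 : \sum_(m < N.+1) b m *+ 'C(N, m) = 1.
  rewrite -[RHS](expr1n _ N) -[in RHS](subrK p 1) exprDn.
  by apply: eq_bigr => m _; rewrite /b mulrC.
(* Average over the binomial time [m], and compare for each [m] with the sets [Y] of [m]
   elements. *)
rewrite -[leLHS]mul1r -[X in X * _ <= _]sum1 big_distrl /=.
rewrite /rprob (partition_big (fun Y : {set {set 'I_n}} => inord #|Y| : 'I_N.+1) xpredT) //=.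
apply: ler_sum => m _.
have mN : (m <= N)%N by rewrite -ltnS.
have -> : \sum_(Y : {set {set 'I_n}} | (Y \subset U) && F Y && (inord #|Y| == m)) rweight U p Y =
    \sum_(Y : {set {set 'I_n}} | (Y \subset U) && F Y && (#|Y| == m)) b m.
  apply: eq_big => [Y|Y /andP[/andP[YU _] /eqP mE]].
    case: (boolP (Y \subset U)) => //= /subset_leq_card; rewrite cU => YN.
    by rewrite -val_eqE /= inordK.
  rewrite /rweight -mE cU inordK //.
  by rewrite ltnS -cU subset_leq_card.
apply: (@le_trans _ _ (\sum_(w : N.-tuple {set 'I_n} | trajectory w)
   b m *+ 'C(N, m) * (N`!%:R^-1 * (F [set s in take m w])%:R))).
  rewrite big_distrr; apply: ler_sum => w tw /=.
  rewrite ler_wpM2l ?mulrn_wge0 // ler_wpM2l ?invr_ge0 ?ler0n // ler_nat.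
  case: (boolP (F _)) => [_|nF]; first by case: pbool.
  by rewrite (introT (pboolP _) (EF w m tw mN nF)).
have Xset (w : N.-tuple {set 'I_n}) : trajectory w ->
   ([set s in take m w] \subset U) && (#|[set s in take m w]| == m).
  move=> /andP[uw /allP wf]; apply/andP; split.
    by apply/subsetP => s; rewrite !inE => /mem_take /wf.
  by rewrite cardsE (card_uniqP (take_uniq _ uw)) size_takel // size_tuple.
rewrite (partition_big (fun w : N.-tuple {set 'I_n} => [set s in take m w])
   (fun Y : {set {set 'I_n}} => (Y \subset U) && (#|Y| == m))) //=.
under [leRHS]eq_bigl do rewrite andbAC.
rewrite [leRHS]big_mkcondr /=; apply: ler_sum => Y /andP[YU /eqP Ym].
apply: (@le_trans _ _ (\sum_(w : N.-tuple {set 'I_n} |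
   trajectory w && ([set s in take m w] == Y)) (b m *+ 'C(N, m) * N`!%:R^-1 * (F Y)%:R))).
  by apply: ler_sum => w /andP[_ /eqP ->]; rewrite mulrA.
rewrite sumr_const; case: (F Y); rewrite ?mulr0 ?mul0rn // mulr1.
rewrite -[leLHS]mulr_natr.
have := card_trajectory_prefix YU; rewrite Ym => cle.
apply: (@le_trans _ _ (b m *+ 'C(N, m) / N`!%:R * (m`! * (N - m)`!)%:R)).
  by rewrite ler_wpM2l ?ler_nat // divr_ge0 ?mulrn_wge0.
rewrite -(mulr_natr (b m)) -(bin_fact mN) !natrM.
rewrite le_eqVlt; apply/orP; left; apply/eqP; field.
by rewrite !pnatr_eq0 -!lt0n !fact_gt0 bin_gt0 mN.
Qed.

End Transfer.
End Process.

(** * Counting supports *)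

Lemma bin_le_exp m l : ('C(m, l) <= m ^ l)%N.
Proof.
apply: (@leq_trans ('C(m, l) * l`!)); first by rewrite leq_pmulr // fact_gt0.
rewrite bin_ffact ffact_prod -[in leqRHS](card_ord l) -prod_nat_const.
by apply: leq_prod => i _; rewrite leq_subr.
Qed.

Lemma sum_subsets_by_card (R : numDomainType) (T : finType) (W : {set T}) (M : nat)
    (g : nat -> R) :
  (forall l, (M < l)%N -> g l = 0) ->
  \sum_(Z : {set T} | Z \subset W) g #|Z| = \sum_(l < M.+1) 'C(#|W|, l)%:R * g l.
Proof.
move=> g0; rewrite (bigID (fun Z : {set T} => (#|Z| <= M)%N)) /= addrC big1 => [|Z]; last first.
  by case/andP=> _; rewrite -ltnNge => /g0.
rewrite add0r (partition_big (fun Z : {set T} => inord #|Z| : 'I_M.+1) xpredT) //=.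
apply: eq_bigr => l _.
rewrite (eq_bigl (fun Z => Z \in [set Z : {set T} | Z \subset W & #|Z| == l])) => [|Z].
  rewrite (eq_bigr (fun=> g l)) => [|Z]; last by rewrite inE => /andP[_ /eqP ->].
  by rewrite sumr_const cards_draws mulr_natl.
rewrite inE -andbA; congr (_ && _).
have [ZM|MZ] := leqP #|Z| M; first by rewrite -val_eqE /= inordK.
by apply/esym/negbTE; apply: contraTneq MZ => ->; rewrite -leqNgt -ltnS.
Qed.

(** [j] is an encoding of the object [h j]; further encodings of the same object only increase the
    right side. *)
Lemma ler_sum_cover (R : numDomainType) (I J : finType) (P : pred I) (Q : pred J)
    (h : J -> I) (F : I -> R) (G : J -> R) :
  (forall j, Q j -> 0 <= G j) ->
  (forall i, P i -> exists j, [/\ Q j, h j = i & F i <= G j]) ->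
  \sum_(i | P i) F i <= \sum_(j | Q j) G j.
Proof.
move=> G0 ex; rewrite [leRHS](bigID (fun j => P (h j))) /= -[leLHS]addr0.
apply: lerD; last by apply: sumr_ge0 => j /andP[/G0].
rewrite (partition_big h P) /=; last by move=> j /andP[].
apply: ler_sum => i Pi; have [j [Qj hj FG]] := ex i Pi.
rewrite (bigD1 j) /=; last by rewrite Qj hj Pi eqxx.
apply: le_trans FG _; rewrite lerDl; apply: sumr_ge0 => k.
by case/andP=> /andP[/andP[/G0]].
Qed.

Section Counting.
Variables (n d : nat).
Implicit Types (s t : {set 'I_n}) (K D Z B Y : {set {set 'I_n}}).

Definition nbhd D : {set {set 'I_n}} := \bigcup_(t in D) nbrs d t.

Lemma card_nbhd D : D \subset ksets n d -> (#|nbhd D| <= #|D| * (d * n))%N.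
Proof.
move=> Dd; rewrite -sum_nat_const.
apply: (@leq_trans (\sum_(t in D) #|nbrs d t|)).
  rewrite /nbhd; elim/big_rec2: _ => [|t m A _ le]; first by rewrite cards0.
  by apply: leq_trans (leq_card_setU _ _) _; rewrite leq_add2l.
by apply: leq_sum => t /(subsetP Dd); exact: card_nbrs.
Qed.

(* [D] is a maximal independent set of the adjacency graph on [K], or its complement. *)
Lemma half_dominating K : K \subset ksets n d ->
  (forall t, t \in K -> nbrs d t :&: K != set0) ->
  exists D, [/\ D \subset K, K :\: D \subset nbhd D & (#|D| <= #|K :\: D|)%N].
Proof.
move=> Kd noiso.
have nn t t' : t \in K -> t' \in nbrs d t -> t \in nbrs d t'.
  by move=> tK; apply: nbrs_sym; apply: (subsetP Kd).
pose P (I : {set {set 'I_n}}) := (I \subset K) && [forall t in I, [disjoint nbrs d t & I]].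
have [I /maxsetP[/andP[IK Iind] Imax] _] : {I | maxset P I & set0 \subset I}.
  by apply: maxset_exists; rewrite /P sub0set; apply/forallP => t; rewrite inE.
have ind t t' : t \in I -> t' \in I -> t' \notin nbrs d t.
  move=> tI t'I; move/forallP/(_ t): Iind; rewrite tI /= => dis.
  by rewrite (disjointFl dis).
have domI t : t \in K -> t \notin I -> t \in nbhd I.
  move=> tK tI; apply/negbNE/negP => tn.
  have tn' t' : t' \in I -> t \notin nbrs d t'.
    by move=> t'I; apply: contra tn => h; apply/bigcupP; exists t'.
  suff E : t |: I = I by move: tI; rewrite -E setU11.
  apply: Imax; last exact: subsetUr.
  rewrite /P subUset sub1set tK IK /=; apply/forallP => t1; apply/implyP => t1I.
  rewrite disjoint_subset; apply/subsetP => t2 t2n; rewrite !inE negb_or.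
  move: t1I; rewrite !inE => /orP[/eqP E|t1I].
    subst t1; apply/andP; split; first by move: t2n; rewrite !inE => /and3P[].
    apply/negP => t2I; move: (tn' t2 t2I); rewrite nn //.
  apply/andP; split; last by apply/negP => t2I; move: (ind t1 t2 t1I t2I); rewrite t2n.
  by apply: contraTneq t2n => ->; exact: tn'.
have [le|lt] := leqP #|I| #|K :\: I|.
  exists I; split=> //; apply/subsetP => t; rewrite inE => /andP[tI tK]; exact: domI.
exists (K :\: I); have -> : K :\: (K :\: I) = I.
  by apply/setP => t; rewrite !inE; case tI: (t \in I); rewrite ?(subsetP IK _ tI) ?andbN //= andNb.
split; [exact: subsetDl| |exact: ltnW].
apply/subsetP => t tI; have /set0Pn[t'] := noiso t (subsetP IK _ tI).
rewrite inE => /andP[t'n t'K]; apply/bigcupP; exists t'; last by apply: nn; rewrite ?(subsetP IK).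
by rewrite inE t'K andbT; apply/negP => t'I; move: (ind _ _ tI t'I); rewrite t'n.
Qed.

Section Prob.
Variables (R : numFieldType) (p : R).
Hypotheses (p0 : 0 <= p) (p1 : p <= 1).
Local Notation y := (1 - p).
Local Notation V := 'C(n, d).
Local Notation U := (ksets n d.+1).
Let y0 : 0 <= y. Proof. by rewrite subr_ge0. Qed.
Let y1 : y <= 1. Proof. by rewrite gerBl. Qed.

Lemma covered_once_sub K : covered_once d K \subset U.
Proof. by apply/subsetP => s; rewrite inE => /andP[]. Qed.

Lemma card_covered_once_small K : K \subset ksets n d ->
  (#|K| * (n - d - #|K|) <= #|covered_once d K|)%N.
Proof.
move=> Kd; apply: leq_trans (card_covered_once Kd); rewrite -sum_nat_const.
by apply: leq_sum => t _; rewrite leq_sub2l // subset_leq_card // subsetIr.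
Qed.

(** Union bound over pairs: [half_dominating] writes [K] as [D :|: Z] with [Z] in the neighbourhood
    of [D] and [j = #|D| <= l = #|Z|]. There are at most [V ^ j] sets [D], and then at most
    [(kappa * (d * n)) ^ l] sets [Z]. *)
Lemma small_bad_prob kappa :
  rprob U p (small_bad d kappa) <=
  \sum_(j < kappa.+1) \sum_(l < kappa.+1 | (0 < j <= l)%N && (j + l <= kappa)%N)
     (V ^ j)%:R * ((kappa * (d * n)) ^ l)%:R * y ^+ ((j + l) * (n - d - (j + l))).
Proof.
(* [G] vanishes outside the admissible sizes, so sums over subsets become sums over sizes up to
   [kappa]. *)
pose G j l : R := if (0 < j <= l)%N && (j + l <= kappa)%N
   then y ^+ ((j + l) * (n - d - (j + l))) else 0.
have G0 j l : 0 <= G j l by rewrite /G; case: ifP => // _; rewrite exprn_ge0.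
have Gbig j l : (kappa < j)%N || (kappa < l)%N -> G j l = 0.
  by rewrite /G => h; rewrite (_ : _ && _ = false) //; lia.
pose P (DZ : {set {set 'I_n}} * {set {set 'I_n}}) := [&& DZ.1 \subset ksets n d,
   DZ.2 \subset nbhd DZ.1, [disjoint DZ.1 & DZ.2], DZ.1 :|: DZ.2 \subset ksets n d,
   (0 < #|DZ.1| <= #|DZ.2|)%N & (#|DZ.1| + #|DZ.2| <= kappa)%N].
apply: (@le_trans _ _ (rprob U p (fun Y =>
   [exists DZ, P DZ && [disjoint covered_once d (DZ.1 :|: DZ.2) & Y]]))).
  apply: rprob_le => // Y _ /existsP[K /and5P[Kd K0 Kk /forallP noiso dis]].
  have [|D [DK dom le]] := half_dominating Kd.
    by move=> t tK; move/implyP: (noiso t); apply.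
  have KE : D :|: (K :\: D) = K.
    by rewrite -{1}(setIidPr DK) setID.
  apply/existsP; exists (D, K :\: D); rewrite /P /= KE dis dom Kd andbT /=.
  have cK : (#|D| + #|K :\: D| = #|K|)%N.
    by rewrite -(cardsID D K) (setIidPr DK).
  rewrite cK Kk le (subset_trans DK Kd) /= !andbT; apply/andP; split.
    by rewrite -setI_eq0; apply/eqP/setP => z; rewrite !inE; case: (z \in D).
  rewrite lt0n cards_eq0; apply: contra K0 => /eqP D0; move: dom.
  by rewrite -KE D0 set0U setD0 /nbhd big_set0 subset0.
apply: le_trans (rprob_union_bound _ _ _ _ _) _ => //.
apply: (@le_trans _ _ (\sum_(D : {set {set 'I_n}} | D \subset ksets n d)
   \sum_(Z : {set {set 'I_n}} | Z \subset nbhd D) G #|D| #|Z|)).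
  rewrite [leRHS]pair_big_dep /= big_mkcond [leRHS]big_mkcond /=; apply: ler_sum => -[D Z] _ /=.
  rewrite /P /=; case: ifPn => [/and5P[-> -> DZ DZd /andP[le1 le2]]|_]; last first.
    by case: ifP.
  rewrite /G le1 le2 rprob_disjoint ?covered_once_sub //.
  apply: ler_wiXn2l => //.
  have cDZ : #|D :|: Z| = (#|D| + #|Z|)%N.
    by rewrite cardsU; move: DZ; rewrite -setI_eq0 => /eqP ->; rewrite cards0 subn0.
  by rewrite -cDZ card_covered_once_small.
apply: (@le_trans _ _ (\sum_(D : {set {set 'I_n}} | D \subset ksets n d)
   \sum_(l < kappa.+1) ((kappa * (d * n)) ^ l)%:R * G #|D| l)).
  apply: ler_sum => D Dd; rewrite (@sum_subsets_by_card _ _ _ kappa) => [|l kl]; last first.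
    by rewrite Gbig // kl orbT.
  apply: ler_sum => l _.
  have [kD|Dk] := ltnP kappa #|D|; first by rewrite Gbig ?kD // !mulr0.
  rewrite ler_wpM2r // ler_nat; apply: leq_trans (bin_le_exp _ _) _.
  case: (posnP l) => [->//|l0]; rewrite leq_exp2r //.
  by apply: leq_trans (card_nbhd Dd) _; rewrite leq_mul2r Dk orbT.
rewrite (@sum_subsets_by_card _ _ _ kappa
   (fun j => \sum_(l < kappa.+1) ((kappa * (d * n)) ^ l)%:R * G j l)) => [|j kj]; last first.
  by rewrite big1 // => l _; rewrite Gbig ?kj // mulr0.
apply: ler_sum => j _; rewrite card_ksets big_distrr [leRHS]big_mkcond /=.
apply: ler_sum => l _; rewrite /G; case: ifP => _; last by rewrite !mulr0.
rewrite mulrA ler_wpM2r ?exprn_ge0 // -!natrM ler_nat leq_mul2r bin_le_exp orbT //.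
Qed.

End Prob.
End Counting.

(** * Union bound over large supports *)

Section Large.
Variables (n d : nat).
Implicit Types (s t : {set 'I_n}) (K D Z B Y H : {set {set 'I_n}}).

Lemma card_star K : K \subset ksets n d -> (#|star d K| <= #|K| * (n - d))%N.
Proof.
move=> Kd; apply: (@leq_trans #|\bigcup_(t in K) cofaces d t|).
  apply/subset_leq_card/subsetP => s; rewrite inE => /andP[sd /existsP[t /andP[tK ts]]].
  by apply/bigcupP; exists t => //; rewrite inE sd.
apply: (@leq_trans (\sum_(t in K) #|cofaces d t|)).
  elim/big_rec2: _ => [|t m A _ le]; first by rewrite cards0.
  by apply: leq_trans (leq_card_setU _ _) _; rewrite leq_add2l.
rewrite -sum_nat_const; apply: leq_sum => t /(subsetP Kd) td.
by rewrite card_cofaces.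
Qed.

Lemma unspanned_disjoint K B : [disjoint unspanned d K B & B].
Proof.
rewrite disjoint_sym disjoint_subset; apply/subsetP => s sB; rewrite !inE negb_and negbK.
by apply/orP; right; apply/pboolP => e g _; apply.
Qed.

Definition tuple_nbhd m (x : {ffun 'I_m -> {set 'I_n}}) : {set {set 'I_n}} :=
  \bigcup_i nbrs d (x i).

Section Real.
Variables (R : realFieldType).

(* A uniformly random [m]-tuple of elements of [K] misses the neighbourhood of
   a vertex with many neighbours with small probability. *)
Lemma dominating_tuple K H b m (z : R) : K \subset ksets n d -> H \subset K ->
  K != set0 -> (0 < b)%N -> 0 <= z ->
  (forall t, t \in H -> (n - d <= b * #|nbrs d t :&: K|)%N) ->
  ((n - d <= b * #|K|)%N -> (1 - (n - d)%:R / (b%:R * #|K|%:R)) ^+ m <= z) ->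
  exists x : {ffun 'I_m -> {set 'I_n}},
    (forall i, x i \in K) /\ #|H :\: tuple_nbhd x|%:R <= z * #|K|%:R.
Proof.
move=> Kd HK K0 b0 z0 Hhigh Hz.
have k0 : (0 < #|K|)%N by rewrite card_gt0.
have kR0 : 0 < #|K|%:R :> R by rewrite ltr0n.
have bR0 : 0 < b%:R :> R by rewrite ltr0n.
pose X := [set x : {ffun 'I_m -> {set 'I_n}} | x \in ffun_on (mem K)].
have cX : #|X| = (#|K| ^ m)%N by rewrite cardsE card_ffun_on card_ord.
suff tot : \sum_(x in X) #|H :\: tuple_nbhd x|%:R <= #|X|%:R * (z * #|K|%:R).
  have [x /andP[xX xle]|no] := pickP [pred x | (x \in X) && (#|H :\: tuple_nbhd x|%:R <= z * #|K|%:R)].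
    by exists x; split=> // i; move: xX; rewrite inE => /ffun_onP; apply.
  exfalso; move: tot; rewrite leNgt => /negP; apply.
  have -> : #|X|%:R * (z * #|K|%:R) = \sum_(x in X) z * #|K|%:R by rewrite sumr_const mulr_natl.
  have [x0 x0X] : exists x, x \in X by apply/card_gt0P; rewrite cX expn_gt0 k0.
  apply: ltr_sum => [|x xX]; first by apply/hasP; exists x0; rewrite ?mem_index_enum.
  by have /= := no x; rewrite xX /= => /negbT; rewrite -ltNge.
(* Exchanging the sums: [t] is missed exactly by the tuples with all entries in [K] outside
   [nbrs d t]. *)
have -> : \sum_(x in X) #|H :\: tuple_nbhd x|%:R =
    \sum_(t in H) ((#|K| - #|nbrs d t :&: K|) ^ m)%:R :> R.
  rewrite -!natr_sum; congr (_%:R).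
  under eq_bigr do rewrite -sum1_card.
  rewrite (exchange_big_dep (mem H)) /=; last by move=> x t _; rewrite inE => /andP[].
  apply: eq_bigr => t tH.
  have -> : (#|K| - #|nbrs d t :&: K|)%N = #|K :\: nbrs d t| by rewrite cardsD setIC.
  rewrite -[m in RHS]card_ord -card_ffun_on -sum1_card; apply: eq_bigl => x.
  rewrite !inE tH andbT; apply/andP/ffun_onP => [[/ffun_onP xK nx] i|xK].
    rewrite inE [_ \in K]xK andbT; apply: contra nx => h; apply/bigcupP; exists i => //.
    by apply: nbrs_sym h; apply: (subsetP Kd); apply: (subsetP HK).
  split; first by apply/ffun_onP => i; have := xK i; rewrite inE => /andP[].
  apply/negP => /bigcupP[i _ h]; have := xK i; rewrite inE => /andP[/negP nh xiK].
  by apply: nh; apply: nbrs_sym h; apply: (subsetP Kd).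
apply: (@le_trans _ _ (\sum_(t in H) #|K|%:R ^+ m * z)); last first.
  rewrite sumr_const cX natrX -[leLHS]mulr_natr -mulrA.
  by rewrite ler_wpM2l ?exprn_ge0 // ler_wpM2l // ler_nat subset_leq_card.
apply: ler_sum => t tH.
have Ht := Hhigh t tH; have le1 : (#|nbrs d t :&: K| <= #|K|)%N by rewrite subset_leq_card ?subsetIr.
(* An element of [H] forces this inequality, which makes the base of the power in [Hz]
   nonnegative. *)
have ab : (n - d <= b * #|K|)%N by apply: leq_trans Ht _; rewrite leq_mul2l le1 orbT.
apply: le_trans (_ : #|K|%:R ^+ m * (1 - (n - d)%:R / (b%:R * #|K|%:R)) ^+ m <= _); last first.
  by rewrite ler_wpM2l ?exprn_ge0 // Hz.
rewrite -exprMn natrX lerXn2r // ?nnegrE ?ler0n //.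
  rewrite mulr_ge0 // subr_ge0 ler_pdivrMr ?mulr_gt0 // mul1r -natrM ler_nat //.
rewrite natrB // mulrBr mulr1 lerD2l lerN2.
have -> : #|K|%:R * ((n - d)%:R / (b%:R * #|K|%:R)) = (n - d)%:R / b%:R :> R.
  by field; rewrite !gt_eqF.
by rewrite ler_pdivrMr // mulrC -natrM ler_nat.
Qed.

Variable (p : R).
Hypotheses (p0 : 0 <= p) (p1 : p <= 1).
Local Notation y := (1 - p).
Local Notation V := 'C(n, d).
Local Notation U := (ksets n d.+1).
Local Notation C := (4 * d.+2 ^ 2)%N.
Let y0 : 0 <= y. Proof. by rewrite subr_ge0. Qed.
Let y1 : y <= 1. Proof. by rewrite gerBl. Qed.

Definition large_event K Y := [exists B : {set {set 'I_n}},
  [&& B \subset star d K, (#|B| <= C * #|K|)%N,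
      covered_once d K \subset unspanned d K B &
      (n * #|K| <= d.+1 * #|unspanned d K B|)%N] &&
  ((B \subset Y) && [disjoint unspanned d K B & Y])].

(** [B] and its unspanned faces are disjoint, so the presence of one and the absence of the other
    are independent. [W] bounds the sum over the choices of [B], [phi] the probability of
    absence. *)
Lemma large_event_prob K (W phi : R) : K \subset ksets n d -> 0 <= phi ->
  (forall S : {set {set 'I_n}}, (#|S| <= #|K| * (n - d))%N ->
     \sum_(B : {set {set 'I_n}} | (B \subset S) && (#|B| <= C * #|K|)%N) p ^+ #|B| <= W) ->
  (forall s : nat, (#|covered_once d K| <= s)%N -> (n * #|K| <= d.+1 * s)%N -> y ^+ s <= phi) ->
  rprob U p (large_event K) <= W * phi.
Proof.
move=> Kd phi0 HW Hphi.
apply: le_trans (rprob_union_bound _ _ _ _ _) _ => //.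
apply: le_trans (_ : \sum_(B : {set {set 'I_n}} |
   (B \subset star d K) && (#|B| <= C * #|K|)%N) p ^+ #|B| * phi <= _); last first.
  by rewrite -big_distrl ler_wpM2r //=; apply: HW; exact: card_star.
rewrite big_mkcond [leRHS]big_mkcond /=; apply: ler_sum => B _.
case: ifPn => [/and4P[BK Bc cov exp]|_]; last first.
  by case: ifP => // _; rewrite mulr_ge0 ?exprn_ge0.
rewrite BK Bc /= rprob_pattern ?unspanned_disjoint //.
- by rewrite ler_wpM2l ?exprn_ge0 // Hphi // subset_leq_card.
- by apply: subset_trans BK _; apply/subsetP => s; rewrite inE => /andP[].
- by apply/subsetP => s; rewrite inE => /andP[].
Qed.

(** An element with fewer than [(n - d) / b] neighbours in [K] has at least a fraction [1 - 1 / b]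
    of its cofaces covered once; the inequality is multiplied by [b]. *)
Lemma covered_once_low K b : K \subset ksets n d ->
  (#|[set t in K | (b * #|nbrs d t :&: K| < n - d)%N]| * ((n - d) * b.-1)
    <= b * #|covered_once d K|)%N.
Proof.
move=> Kd; apply: (@leq_trans (b * \sum_(t in K) (n - d - #|nbrs d t :&: K|))%N); last first.
  by rewrite leq_mul2l card_covered_once ?orbT.
rewrite -sum_nat_const big_distrr [leqRHS](bigID (fun t => (b * #|nbrs d t :&: K| < n - d)%N)) /=.
apply: leq_trans (leq_addr _ _).
rewrite (eq_bigl (fun t => (t \in K) && (b * #|nbrs d t :&: K| < n - d)%N)) => [|t]; last first.
  by rewrite inE.
apply: leq_sum => t /andP[_]; rewrite mulnBr; move: (n - d)%N #|_| => a l.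
case: b => [|b'] h; first by rewrite muln0.
by rewrite mulnC [leqRHS](_ : _ = b' * a + (a - b'.+1 * l))%N; [exact: leq_addr | move: h; rewrite !mulSn; lia].
Qed.

(** A set [K] of size [k] is encoded by a tuple of [m k] elements, the part of [K] in their
    neighbourhood and the remaining [r] elements, which gives the first three factors. [W k]
    accounts for [B] and [psi k r] for the missing faces; [u] stands for the number of elements of
    [K] with few neighbours in [K]. *)
Lemma large_bad_prob kappa b (m : nat -> nat) (z : R) (W : nat -> R) (psi : nat -> nat -> R) :
  (0 < b)%N -> 0 <= z ->
  (forall k r, 0 <= psi k r) ->
  (forall k, (kappa < k)%N -> (n - d <= b * k)%N ->
     (1 - (n - d)%:R / (b%:R * k%:R)) ^+ m k <= z) ->
  (forall k (S : {set {set 'I_n}}), (#|S| <= k * (n - d))%N ->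
     \sum_(B : {set {set 'I_n}} | (B \subset S) && (#|B| <= C * k)%N) p ^+ #|B| <= W k) ->
  (forall k r u (s : nat), (kappa < k)%N -> (u * ((n - d) * b.-1) <= b * s)%N ->
     (n * k <= d.+1 * s)%N -> r%:R <= u%:R + z * k%:R -> y ^+ s <= psi k r) ->
  rprob U p (large_bad d kappa) <=
  \sum_(k < V.+1 | (kappa < k)%N)
    (V ^ m k)%:R * (2 ^ (m k * (d * n)))%:R * (\sum_(r < k.+1) 'C(V, r)%:R * psi k r) * W k.
Proof.
move=> b0 z0 psi0 Hz HW Hpsi.
have W0 k : 0 <= W k.
  apply: le_trans (HW k set0 _); last by rewrite cards0.
  by apply: sumr_ge0 => B _; rewrite exprn_ge0.
pose PK k K := (K \subset ksets n d) && (#|K| == k).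
apply: (@le_trans _ _ (rprob U p (fun Y =>
   [exists k : 'I_V.+1, (kappa < k)%N && [exists K, PK k K && large_event K Y]]))).
  apply: rprob_le => // Y _ /existsP[K /and3P[Kd kK /existsP[B /and5P[BK Bc BY cov /andP[exp dis]]]]].
  have KV : (#|K| < V.+1)%N by rewrite ltnS -card_ksets subset_leq_card.
  apply/existsP; exists (Ordinal KV); rewrite /= kK; apply/existsP; exists K.
  rewrite /PK Kd eqxx; apply/existsP; exists B; rewrite BK Bc cov exp BY; exact: dis.
apply: le_trans (rprob_union_bound _ _ _ _ _) _ => //.
apply: ler_sum => k kk.
apply: le_trans (rprob_union_bound _ _ _ _ _) _ => //.
pose Q (j : {ffun 'I_(m k) -> {set 'I_n}} * ({set {set 'I_n}} * {set {set 'I_n}})) :=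
  (j.1 \in ffun_on (mem (ksets n d))) &&
  ((j.2.1 \subset tuple_nbhd j.1) && (j.2.2 \subset ksets n d)).
pose psi' r := if (r <= k)%N then psi k r else 0.
have psi'0 r : 0 <= psi' r by rewrite /psi'; case: ifP.
apply: le_trans (_ : \sum_(j | Q j) W k * psi' #|j.2.2| <= _).
  apply: (@ler_sum_cover _ _ _ _ _ (fun j => j.2.1 :|: j.2.2)) => [j _|K /andP[Kd /eqP Kk]].
    by rewrite mulr_ge0.
  pose H := [set t in K | (n - d <= b * #|nbrs d t :&: K|)%N].
  have HK : H \subset K by apply/subsetP => t; rewrite inE => /andP[].
  have [|||t|le|x [xK xle]] := @dominating_tuple K H b (m k) z Kd HK.
  - by rewrite -card_gt0 Kk; lia.
  - by [].
  - by [].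
  - by rewrite inE => /andP[].
  - by rewrite Kk; apply: Hz => //; rewrite -Kk.
  exists (x, (K :&: tuple_nbhd x, K :\: tuple_nbhd x)); split=> /=.
  - apply/and3P; split=> /=; first by apply/ffun_onP => i; apply: (subsetP Kd).
      exact: subsetIr.
    exact: subset_trans (subsetDl _ _) Kd.
  - by rewrite setID.
  have lek : (#|K :\: tuple_nbhd x| <= k)%N by apply: leq_trans (subset_leq_card (subsetDl _ _)) _; rewrite Kk.
  rewrite /psi' lek; apply: large_event_prob => //; first by move=> S; rewrite Kk => /HW.
  move=> s cs ns; rewrite Kk in ns.
  apply: (Hpsi k _ #|K :\: H| s) => //.
    apply: (@leq_trans (b * #|covered_once d K|)%N); last by rewrite leq_mul2l cs orbT.
    apply: leq_trans (covered_once_low b Kd); rewrite leq_mul2r; apply/orP; right.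
    apply/subset_leq_card/subsetP => t; rewrite !inE negb_and -ltnNge.
    by move=> /andP[/orP[/negbTE ->|lt]] // ->; rewrite lt.
  (* Outside the neighbourhood of the tuple remain elements with few neighbours in [K], and at most
     [z * k] others. *)
  rewrite Kk in xle; apply: le_trans (lerD (lexx _) xle); rewrite -natrD ler_nat.
  apply: (@leq_trans #|(K :\: H) :|: (H :\: tuple_nbhd x)|); last exact: leq_card_setU.
  apply/subset_leq_card/subsetP => t; rewrite in_setU !in_setD => /andP[-> ->] /=.
  by rewrite andbT orNb.
rewrite -big_distrr /= mulrC ler_wpM2r //.
rewrite -(pair_big_dep (fun x => x \in ffun_on (mem (ksets n d)))
  (fun x (DR : {set {set 'I_n}} * {set {set 'I_n}}) =>
     (DR.1 \subset tuple_nbhd x) && (DR.2 \subset ksets n d)) (fun _ DR => psi' #|DR.2|)) /=.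
set T := \sum_(r < k.+1) _.
have TE : \sum_(Z : {set {set 'I_n}} | Z \subset ksets n d) psi' #|Z| = T.
  rewrite (@sum_subsets_by_card _ _ _ k) => [|l kl]; last by rewrite /psi' leqNgt kl.
  rewrite card_ksets; apply: eq_bigr => r _.
  by rewrite /psi' -ltnS ltn_ord.
have T0 : 0 <= T by rewrite -TE; apply: sumr_ge0.
apply: (@le_trans _ _ (\sum_(x : {ffun 'I_(m k) -> {set 'I_n}} | x \in ffun_on (mem (ksets n d)))
    (2 ^ (m k * (d * n)))%:R * T)); last first.
  by rewrite sumr_const card_ffun_on card_ord card_ksets -mulrA -[leLHS]mulr_natl.
apply: ler_sum => x /ffun_onP xd.
rewrite -(pair_big_dep (fun D : {set {set 'I_n}} => D \subset tuple_nbhd x)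
  (fun _ (Z : {set {set 'I_n}}) => Z \subset ksets n d) (fun _ Z => psi' #|Z|)) /=.
under eq_bigr do rewrite TE.
rewrite sumr_const -[leLHS]mulr_natl ler_wpM2r // ler_nat.
rewrite (eq_card (_ : _ =i powerset (tuple_nbhd x))) => [|D]; last by rewrite !inE.
rewrite card_powerset leq_exp2l //.
apply: (@leq_trans (\sum_(i < m k) #|nbrs d (x i)|)).
  rewrite /tuple_nbhd; elim/big_rec2: _ => [|i l A _ le]; first by rewrite cards0.
  by apply: leq_trans (leq_card_setU _ _) _; rewrite leq_add2l.
rewrite -[m k in leqRHS]card_ord -sum_nat_const; apply: leq_sum => i _.
exact: card_nbrs (xd i).
Qed.

End Real.
End Large.

(** * Numerical bounds *)

(** The blocks are the sets of cofaces; two of them meet in at most one face, and only for adjacent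
    [d]-sets. *)
Lemma has_isolated_prob (R : realFieldType) n d (p : R) : 0 <= p -> p <= 1 -> 
  rprob (ksets n d.+1) p (fun Y => ~~ has_isolated d Y) *
    ('C(n, d)%:R * (1 - p) ^+ (n - d)) ^+ 2 <=
  'C(n, d)%:R * (1 - p) ^+ (n - d) +
  'C(n, d)%:R * (d * n)%:R * (1 - p) ^+ (2 * (n - d)).-1.
Proof.
move=> p0 p1; rewrite -card_ksets.
apply: (@rprob_all_blocks_hit _ _ _ _ _ _ _ _ _ (nbrs d)) => // [t td|t td|t t' td t'd t't].
- by rewrite card_cofaces //; split=> //; apply/subsetP => s; rewrite inE => /andP[].
- exact: card_nbrs.
have [->|/set0Pn[s]] := eqVneq (cofaces d t :&: cofaces d t') set0; first by rewrite cards0.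
rewrite in_setI 2!inE [s \in cofaces d t']inE => /andP[/andP[sd ts] /andP[_ t's]].
have [t'n _] : t' \in nbrs d t /\ s = t :|: t' by apply: cofaces_nbrs => //; rewrite inE.
rewrite t'n; apply: (@leq_trans #|[set t :|: t']|); last by rewrite cards1.
apply/subset_leq_card/subsetP => s'; rewrite !inE => /andP[/andP[s'd ts'] /andP[_ t's']].
have [_ ->] : t' \in nbrs d t /\ s' = t :|: t' by apply: cofaces_nbrs => //; rewrite inE.
exact: eqxx.
Qed.

Lemma geometric_sum_le (R : realFieldType) (M : nat) (rho : R) : 0 <= rho -> rho <= 2^-1 ->
  \sum_(k < M | (0 < k)%N) rho ^+ k <= 2 * rho.
Proof.
move=> r0 r1.
have h N : \sum_(k < N) rho ^+ k <= 2.
  elim: N => [|N IH]; first by rewrite big_ord0.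
  rewrite big_ord_recl expr0.
  under eq_bigr do rewrite lift0 exprS.
  by rewrite -big_distrr /=; nra.
case: M => [|M]; first by rewrite big_ord0; lra.
rewrite big_mkcond big_ord_recl /= add0r.
rewrite (eq_bigr (fun i : 'I_M => rho * rho ^+ i)) => [|i _]; last by rewrite -exprS.
by rewrite -big_distrr /= mulrC ler_wpM2r // h.
Qed.

Section Numeric.
Variables (R : realType) (n d : nat) (L : R).
Hypotheses (d2 : (2 <= d)%N) (nL : n%:R = expR L) (dn : (2 * d <= n)%N) (L0 : 0 < L).

Local Notation D := (d%:R : R).
Local Notation a := ((n - d)%:R : R).
Local Notation x := (D - 8^-1).
Local Notation V := 'C(n, d).
Local Notation U := (ksets n d.+1).

(** Here [L] is the logarithm of [n], and [miss ^+ (n - d)] is [n] to the power [1/8 - d]: the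
    expected number of isolated faces is of order [n ^ (1/8)]. *)
Definition miss : R := expR (- (x * L / a)).
Local Notation p := (1 - miss).

Lemma D_ge2 : 2 <= D. Proof. by rewrite (ler_nat _ 2). Qed.

Lemma a_ge : n%:R <= 2 * a.
Proof. by rewrite -natrM ler_nat; lia. Qed.

Lemma a_gt0 : 0 < a.
Proof. by rewrite ltr0n; lia. Qed.

Lemma missX s : miss ^+ s = expR (- (x * L * (s%:R / a))).
Proof. by rewrite -expRM_natl; congr expR; rewrite mulrN; congr (- _); ring. Qed.

Lemma miss_gt0 : 0 < miss. Proof. exact: expR_gt0. Qed.

Lemma miss_le1 : miss <= 1.
Proof.
have x0 : 0 <= x by have := D_ge2; lra.
by rewrite expR_le1 oppr_le0 divr_ge0 ?ler0n // mulr_ge0 // ltW.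
Qed.

Lemma p_ge0 : 0 <= p. Proof. by rewrite subr_ge0 miss_le1. Qed.
Lemma p_le1 : p <= 1. Proof. by rewrite gerBl ltW // miss_gt0. Qed.

Lemma p_le : p <= x * L / a.
Proof. by rewrite /miss; have := expR_ge1Dx (- (x * L / a)); lra. Qed.

Lemma V_le : V%:R <= expR (D * L).
Proof. by rewrite expRM_natl -nL -natrX ler_nat bin_le_exp. Qed.

(** As [n <= 2 * a], the binomial coefficient is at least [n ^ d] over a constant, which is absorbed
    by [n ^ (1/16)]. *)
Lemma V_ge : (2 ^ d * d`!)%:R <= expR (L / 16) -> expR ((D - 16^-1) * L) <= V%:R.
Proof.
move=> cst.
have h : n%:R ^+ d <= 2 ^+ d * (V * d`!)%:R :> R.
  rewrite bin_ffact ffact_prod natr_prod.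
  apply: (@le_trans _ _ (\prod_(i < d) (2 * a))).
    by rewrite prodr_const card_ord lerXn2r ?nnegrE ?mulr_ge0 ?ler0n // a_ge.
  rewrite big_split /= prodr_const card_ord ler_wpM2l ?exprn_ge0 //.
  apply: ler_prod => i _; rewrite ler0n ler_nat leq_sub2l //.
  exact: ltnW.
rewrite -(ler_pM2r (expR_gt0 (L / 16))) -expRD.
have -> : (D - 16^-1) * L + L / 16 = D * L by ring.
rewrite expRM_natl -nL; apply: le_trans h _; rewrite natrM mulrCA ler_wpM2l //.
by move: cst; rewrite natrM natrX.
Qed.

(** The expected number [V * q] of isolated faces is at least [n ^ (1/16)]. Each of the two terms of
    the second moment bound is at most [n ^ (-1/16)] times its square. *)
Lemma isolated_bad : (2 ^ d * d`!)%:R <= expR (L / 16) -> 4 * D * L <= expR L ->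
  2 * D <= expR (7 / 8 * L) ->
  rprob U p (fun Y => ~~ has_isolated d Y) <= 2 * expR (- (L / 16)).
Proof.
move=> c1 c2 c3; have D2 := D_ge2; have Lp := L0.
have Vge := V_ge c1.
have V0 : 0 < V%:R :> R by apply: lt_le_trans Vge; exact: expR_gt0.
have [p0 p1] := (p_ge0, p_le1).
have := has_isolated_prob n d p0 p1.
have -> : 1 - p = miss by ring.
set P := rprob _ _ _.
have P0 : 0 <= P by apply: rprob_ge0.
set q := miss ^+ (n - d).
have q0 : 0 < q by rewrite exprn_gt0 // miss_gt0.
have qE : q = expR (- (x * L)).
  by rewrite /q missX divff ?mulr1 // gt_eqF // a_gt0.
(* A common coface of two isolated faces costs a factor [miss^-1], so at most 2. *)
have m2 : 2^-1 <= miss.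
  have : p <= 2^-1.
    apply: le_trans p_le _; rewrite ler_pdivrMr ?a_gt0 //.
    by have := a_ge; rewrite nL; nra.
  lra.
have -> : miss ^+ (2 * (n - d)).-1 = q ^+ 2 / miss.
  have -> : q ^+ 2 = miss ^+ (2 * (n - d)).-1.+1.
    by rewrite prednK ?muln_gt0 ?subn_gt0 /= -?exprM 1?mulnC //; lia.
  by rewrite exprSr mulfK // gt_eqF // miss_gt0.
move=> h.
have Vq : expR (L / 16) <= V%:R * q.
  have -> : L / 16 = (D - 16^-1) * L + - (x * L) by field.
  by rewrite expRD qE ler_wpM2r // expR_ge0.
have e1 : expR (L / 16) * expR (- (L / 16)) = 1 by exact: expRxMexpNx_1.
set e := expR (- (L / 16)) in e1 *.
have e0 : 0 < e by exact: expR_gt0.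
have t1 : V%:R * q <= e * (V%:R * q) ^+ 2.
  have Vq0 : 0 < V%:R * q by rewrite mulr_gt0.
  have e1w : 1 <= e * (V%:R * q) by rewrite -[leLHS]e1 mulrC; apply: ler_wpM2l => //; exact: ltW.
  by rewrite expr2 mulrA; apply: ler_peMl => //; exact: ltW.
have t2 : V%:R * (d * n)%:R * (q ^+ 2 / miss) <= e * (V%:R * q) ^+ 2.
  have dnV : 2 * (d * n)%:R <= e * V%:R.
    apply: le_trans (_ : e * expR ((D - 16^-1) * L) <= _); last by rewrite ler_wpM2l // ltW.
    rewrite /e -expRD natrM nL.
    apply: (@le_trans _ _ (expR (7 / 8 * L) * expR L)).
      by rewrite mulrA ler_wpM2r ?expR_ge0.
    by rewrite -expRD ler_expR; nra.
  have im : miss^-1 <= 2 by rewrite -[leRHS]invrK lef_pV2 ?posrE ?miss_gt0 ?invr_gt0 //.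
  have -> : V%:R * (d * n)%:R * (q ^+ 2 / miss) = (V%:R * q ^+ 2) * ((d * n)%:R / miss) by ring.
  have -> : e * (V%:R * q) ^+ 2 = (V%:R * q ^+ 2) * (e * V%:R) by ring.
  apply: ler_wpM2l; first by apply: mulr_ge0; [exact: ltW | apply: exprn_ge0; exact: ltW].
  apply: (@le_trans _ _ ((d * n)%:R * 2)); first by rewrite ler_wpM2l.
  by rewrite mulrC.
have Vq2 : 0 < (V%:R * q) ^+ 2 by rewrite exprn_gt0 // mulr_gt0.
rewrite -(ler_pM2r Vq2); apply: le_trans h _.
by have := lerD t1 t2; lra.
Qed.

(** Each term is at most [rho ^+ (j + l)] with [rho = n ^ (-1/8)]; two geometric series give
    [4 * rho ^+ 2]. *)
Lemma small_bad_le kappa : kappa%:R <= expR (L / 4) -> D <= expR (L / 16) ->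
  64 * D <= expR (3 / 4 * L) -> 2 <= expR (L / 8) ->
  rprob U p (small_bad d kappa) <= 4 * expR (- (L / 4)).
Proof.
have D2 := D_ge2; have Lp := L0; move=> kL c1 c2 c3.
have [p0 p1] := (p_ge0, p_le1).
apply: le_trans (small_bad_prob _ _ p0 p1 _) _.
have -> : 1 - p = miss by ring.
set rho := expR (- (L / 8)).
have rho0 : 0 <= rho by exact: expR_ge0.
have rho2 : rho <= 2^-1.
  by rewrite /rho expRN lef_pV2 // posrE // expR_gt0.
have an := a_ge; have a0 := a_gt0.
have key j l : (0 < j <= l)%N && (j + l <= kappa)%N ->
  (V ^ j)%:R * ((kappa * (d * n)) ^ l)%:R * miss ^+ ((j + l) * (n - d - (j + l))) <=
  rho ^+ j * rho ^+ l.
  move=> /andP[/andP[j0 jl] jlk].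
  have kle : (j + l)%:R <= expR (L / 4) :> R by apply: le_trans kL; rewrite ler_nat.
  have k2n : 32 * D * expR (L / 4) <= a.
    have e : expR L = expR (3 / 4 * L) * expR (L / 4) by rewrite -expRD; congr expR; field.
    have := expR_gt0 (L / 4); rewrite nL e in an; nra.
  have kna : (j + l <= n - d)%N.
    by rewrite -(ler_nat R); have := expR_gt0 (L / 4); nra.
  have f1 : (V ^ j)%:R <= expR (D * L * j%:R).
    by rewrite natrX expRM_natr lerXn2r ?nnegrE ?expR_ge0 ?ler0n // V_le.
  (* [21 / 16 = 1 / 4 + 1 / 16 + 1] collects the exponents of [kappa], [d] and [n]. *)
  have f2 : ((kappa * (d * n)) ^ l)%:R <= expR (21 / 16 * L * l%:R).
    rewrite natrX expRM_natr lerXn2r ?nnegrE ?expR_ge0 ?ler0n //.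
    have -> : 21 / 16 * L = L / 4 + (L / 16 + L) by field.
    rewrite !expRD !natrM nL ler_pM ?mulr_ge0 ?expR_ge0 ?ler0n //.
    by rewrite ler_wpM2r ?expR_ge0.
  rewrite missX -!expRM_natl.
  apply: (le_trans (ler_wpM2r (expR_ge0 _) (ler_pM (ler0n _ _) (ler0n _ _) f1 f2))).
  rewrite -!expRD.
  rewrite ler_expR natrM natrB // natrD.
  set J := j%:R; set l' := l%:R.
  rewrite natrD -/J -/l' in kle.
  have J1 : 1 <= J by rewrite ler1n.
  have Jl : J <= l' by rewrite ler_nat.
  set k := J + l' in kle *.
  have k0 : 0 <= k by rewrite addr_ge0.
  (* Replacing [k * (a - k) / a] by [k] thus costs at most [L * k / 32] in the exponent. *)
  have ka : x * (k / a) <= 32^-1.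
    rewrite mulrA ler_pdivrMr //; have := expR_gt0 (L / 4).
    by have : x * k <= D * expR (L / 4); [rewrite ler_pM //; lra | lra].
  have -> : - (x * L * (k * (a - k) / a)) = - (x * L * k) + L * k * (x * (k / a)).
    by field; rewrite gt_eqF.
  have : L * k * (x * (k / a)) <= L * k * 32^-1 by rewrite ler_wpM2l // mulr_ge0 // ltW.
  (* Since [D > 21 / 16] and [j <= l], the worst case is [j = l]; this is where the dominating set
     of at most half the size matters. *)
  have : (D - 21 / 16) * (l' - J) >= 0 by rewrite mulr_ge0; lra.
  move=> h1 h2.
  suff : D * J + 21 / 16 * l' - x * k + k * 32^-1 <= - (k / 8).
    by move=> h; have := ler_wpM2l (ltW L0) h; rewrite /k in h2 *; nra.
  by rewrite /k; nra.
apply: (@le_trans _ _ (\sum_(j < kappa.+1 | (0 < j)%N) \sum_(l < kappa.+1 | (0 < l)%N) rho ^+ j * rho ^+ l)).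
  rewrite [leRHS]big_mkcond /=; apply: ler_sum => j _.
  case: ifPn => j0; last by rewrite big_pred0.
  rewrite big_mkcond [leRHS]big_mkcond /=; apply: ler_sum => l _.
  case: ifPn => [h|_]; last by case: ifP => // _; rewrite mulr_ge0 ?exprn_ge0.
  rewrite ifT; first by apply: key; rewrite j0.
  by case/andP: h => jl _; apply: leq_trans jl.
under eq_bigr do rewrite -big_distrr /=.
rewrite -big_distrl /=.
have := geometric_sum_le kappa.+1 rho0 rho2; set S := \sum_(_ < _ | _) _ => S2.
have S0 : 0 <= S by apply: sumr_ge0 => i _; rewrite exprn_ge0.
have -> : expR (- (L / 4)) = rho * rho by rewrite /rho -expRD; congr expR; field.
nra.
Qed.

End Numeric.

(** * Exponential estimates for sums over subsets *)

Lemma expX_1D_le (R : realType) (t : R) m : 0 <= 1 + t -> (1 + t) ^+ m <= expR (t * m%:R).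
Proof. by move=> t0; rewrite expRM_natr lerXn2r ?nnegrE ?expR_ge0 ?expR_ge1Dx. Qed.

(** Multiply each term by [w ^+ (J - #|B|) >= 1], drop the size condition and apply the binomial
    theorem to [1 + p / w]. *)
Lemma sum_small_subsets_le (R : realType) (T : finType) (S : {set T}) J (p w : R) :
  0 <= p -> 1 <= w ->
  \sum_(B : {set T} | (B \subset S) && (#|B| <= J)%N) p ^+ #|B|
    <= w ^+ J * expR (p * #|S|%:R / w).
Proof.
move=> p0 w1; have w0 : 0 < w by apply: lt_le_trans w1.
have pw0 : 0 <= p / w by rewrite divr_ge0 // ltW.
apply: (@le_trans _ _ (w ^+ J * \sum_(B : {set T} | B \subset S) (p / w) ^+ #|B| * 1 ^+ (#|S| - #|B|))).
  rewrite big_distrr big_mkcondr /=; apply: ler_sum => B _; rewrite expr1n mulr1.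
  case: ifP => [BJ|_]; last by rewrite mulr_ge0 ?exprn_ge0 // ltW.
  rewrite expr_div_n mulrCA ler_peMr ?exprn_ge0 // -(subnK BJ) exprD mulfK ?expf_neq0 ?gt_eqF //.
  exact: exprn_ege1.
rewrite sum_subsets_card addrC; apply: ler_wpM2l; first by rewrite exprn_ge0 // ltW.
apply: le_trans (expX_1D_le _ _) _; first by rewrite addr_ge0.
by rewrite ler_expR mulrAC.
Qed.

(** Compare with a single term of the expansion of [(1 + k / N) ^+ N], which is at most [expR k];
    [r] may differ from [k]. *)
Lemma bin_le_expR (R : realType) (N r k : nat) : (0 < k)%N -> (0 < N)%N ->
  'C(N, r)%:R <= (N%:R / k%:R) ^+ r * expR k%:R :> R.
Proof.
move=> k0 N0; have kR : 0 < k%:R :> R by rewrite ltr0n.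
have NR : 0 < N%:R :> R by rewrite ltr0n.
have z0 : 0 <= k%:R / N%:R :> R by rewrite divr_ge0.
have h : 'C(N, r)%:R * (k%:R / N%:R) ^+ r <= expR k%:R :> R.
  apply: (@le_trans _ _ ((1 + k%:R / N%:R) ^+ N)).
    have [rN|Nr] := leqP r N; last by rewrite bin_small // mul0r exprn_ge0 // addr_ge0.
    rewrite exprDn (bigD1 (Ordinal (rN : (r < N.+1)%N))) //= expr1n mul1r mulr_natl lerDl.
    by apply: sumr_ge0 => i _; rewrite expr1n mul1r mulrn_wge0 ?exprn_ge0.
  apply: le_trans (expX_1D_le _ _) _; first by rewrite addr_ge0.
  by rewrite ler_expR divfK // gt_eqF.
have -> : (N%:R / k%:R : R) ^+ r = ((k%:R / N%:R) ^+ r)^-1 by rewrite -exprVn invf_div.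
by rewrite mulrC ler_pdivlMr // exprn_gt0 // divr_gt0.
Qed.

(** The factor [mu] is still at least [D - 1/4], so the terms in [r] add up to at most 0. The
    expansion term [k / (D + 1)] then outweighs the loss due to the undominated elements. *)
Lemma exponent_bound (R : realFieldType) (D r k : R) : 2 <= D -> 0 <= r -> 0 <= k ->
  (D - 4^-1) * r - (D - 8^-1) * ((1 - (16 * D)^-1) ^+ 2 * (r - (128 * D * (D + 1))^-1 * k)
     + (16 * D)^-1 * (k / (D + 1)))
  <= - (6 * (128 * (D + 1))^-1 * k).
Proof.
move=> D2 r0 k0; pose v := D^-1; pose e := (D + 1)^-1.
have Dv : D * v = 1 by rewrite mulfV //; lra.
have v0 : 0 < v by rewrite invr_gt0; lra.
have v2 : v <= 2^-1 by nra.
have e0 : 0 < e by rewrite invr_gt0; lra.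
have -> : (16 * D)^-1 = v / 16 by rewrite invfM mulrC.
have -> : (128 * D * (D + 1))^-1 = v * e / 128 by rewrite !invfM -/v -/e; ring.
have -> : (128 * (D + 1))^-1 = e / 128 by rewrite !invfM -/e; ring.
rewrite -/e; pose mu := (D - 8^-1) * (1 - v / 16) ^+ 2.
have muE : mu = D - 4^-1 + v / 64 + (v / 256 - v * v / 2048).
  have -> : mu = D - (D * v) / 8 - 8^-1 + v / 64 + ((D * v) * v / 256 - v * v / 2048).
    by rewrite /mu; field.
  by rewrite Dv; field.
have mu1 : D - 4^-1 <= mu by rewrite muE; nra.
have mu2 : mu <= D by rewrite muE; nra.
have -> : (D - 4^-1) * r - (D - 8^-1) * ((1 - v / 16) ^+ 2 * (r - v * e / 128 * k) + v / 16 * (k * e))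
   = (D - 4^-1 - mu) * r + mu * v * (e * k) / 128 - (D * v - v / 8) * (e * k) / 16.
  by rewrite /mu; field.
rewrite Dv; have ek : 0 <= e * k by rewrite mulr_ge0 // ltW.
have h1 : (D - 4^-1 - mu) * r <= 0 by nra.
have h2 : mu * v <= 1 by nra.
have h3 : mu * v * (e * k) <= e * k by nra.
nra.
Qed.

(** * Numerical bound for large supports *)

Section Large.
Variables (R : realType) (n d : nat) (L : R).
Hypotheses (d2 : (2 <= d)%N) (nL : n%:R = expR L) (dn : (2 * d <= n)%N) (L0 : 0 < L).

Local Notation D := (d%:R : R).
Local Notation a := ((n - d)%:R : R).
Local Notation x := (D - 8^-1).
Local Notation V := 'C(n, d).
Local Notation U := (ksets n d.+1).
Local Notation p := (1 - miss n d L).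
Local Notation b := (16 * d)%N.
Local Notation A := (16 * d * (128 * d * d.+1))%N.
Local Notation C := (4 * d.+2 ^ 2)%N.
Local Notation c0 := ((128 * (D + 1))^-1).
Local Notation z := ((128 * D * (D + 1))^-1).

(** In units of [c0 * L * k], the exponent receives -6 from the remainder against the missing faces,
    and +1 each from the tuple and from [B]. The terms linear in [k] alone add up to [2 * A * d + 3]
    times [k], which [cst] covers. A geometric series in [k] remains. *)
Lemma large_bad_le kappa : expR (L / 4) < kappa.+1%:R -> 1 <= D * L ->
  (D * L) ^+ C <= expR (c0 * L) -> (2 * A * d + 3)%:R <= c0 * L ->
  (d * A)%:R <= c0 * a -> 2 <= expR (c0 * L) ->
  rprob U p (large_bad d kappa) <= 2 * expR (- (c0 * L)).
Proof.
move=> kL DL1 DLC cst cA c2.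
have D2 := D_ge2 R d2; have Lp := L0.
have [p0 p1] := (p_ge0 n d2 L0, p_le1 n d L).
have a0 : 0 < a := a_gt0 d2 dn L0.
have an : n%:R <= 2 * a := a_ge d2 dn L0.
have c00 : 0 < c0 by rewrite invr_gt0; lra.
have z0 : 0 < z by rewrite invr_gt0 !mulr_gt0 //; lra.
have zz0 : 0 < 128 * D * (D + 1) by rewrite -invr_gt0.
have an0 : (0 < n - d)%N by rewrite -(ltr0n R).
(* As [A = b / z], this length makes [m k * a / (b * k)] about [1 / z], enough to push the
   undominated fraction below [z]. *)
pose m k := ((k * A) %/ (n - d))%N.
have m1 k : (m k)%:R * a <= k%:R * A%:R by rewrite -!natrM ler_nat leq_divM.
have m2 k : k%:R * A%:R <= ((m k)%:R + 1) * a.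
  by rewrite natr1 -!natrM ler_nat ltnW // ltn_ceil.
pose W k := (D * L) ^+ (C * k) * expR k%:R.
(* A convex combination of two lower bounds for [s / a], from elements with few neighbours and, with
   weight [(16 * D)^-1], from the cone homotopy. One factor [1 - (16 * D)^-1] is a weight, the other
   the fraction [1 - 1 / b]. *)
pose psi k r := expR (- (x * L * ((1 - (16 * D)^-1) ^+ 2 * (r%:R - z * k%:R)
     + (16 * D)^-1 * (k%:R / (D + 1))))).
have kk k : (kappa < k)%N -> expR (L / 4) <= k%:R.
  by move=> h; apply/ltW/(lt_le_trans kL); rewrite ler_nat.
apply: (@le_trans _ _ (\sum_(k < V.+1 | (kappa < k)%N) expR (- (c0 * L)) ^+ k)); last first.
  apply: le_trans (geometric_sum_le V.+1 (expR_ge0 _) _); last first.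
    by rewrite expRN lef_pV2 // posrE // expR_gt0.
  rewrite big_mkcond [leRHS]big_mkcond /=; apply: ler_sum => k _.
  case: ifP => h; last by case: ifP => // _; rewrite exprn_ge0 ?expR_ge0.
  by rewrite (leq_ltn_trans _ h).
apply: le_trans (@large_bad_prob n d R p p0 p1 kappa b m z W psi _ _ _ _ _ _) _.
- by rewrite muln_gt0 (leq_trans _ d2).
- exact: ltW.
- by move=> k r; exact: expR_ge0.
- move=> k hk ab.
  have k0 : 0 < k%:R :> R by apply: lt_le_trans (kk k hk); exact: expR_gt0.
  have bk0 : 0 < b%:R * k%:R :> R by rewrite mulr_gt0 // ltr0n muln_gt0 (leq_trans _ d2).
  have q1 : a / (b%:R * k%:R) <= 1 by rewrite ler_pdivrMr // mul1r -natrM ler_nat.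
  apply: le_trans (expX_1D_le _ _) _; first by rewrite subr_ge0.
  rewrite mulNr expRN -[leRHS]invrK lef_pV2 ?posrE ?expR_gt0 ?invr_gt0 //.
  (* The summand 1 absorbs the rounding in [m k], because [a <= b * k]. *)
  apply: le_trans (_ : 1 + a / (b%:R * k%:R) * (m k)%:R <= _); last exact: expR_ge1Dx.
  rewrite invrK [_ / _ * (m k)%:R]mulrAC -lerBlDl ler_pdivlMr // mulrBl mul1r; have := m2 k.
  have -> : 128 * D * (D + 1) * (b%:R * k%:R) = k%:R * A%:R by rewrite !natrM -[in RHS]natr1; ring.
  move: q1; rewrite ler_pdivrMr // mul1r; lra.
- move=> k S hS; have w0 : 0 < D * L by apply: lt_le_trans DL1.
  apply: le_trans (sum_small_subsets_le S _ p0 DL1) _.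
  apply: ler_wpM2l; first by rewrite exprn_ge0 // ltW.
  rewrite ler_expR ler_pdivrMr //.
  apply: (@le_trans _ _ (x * L / a * (k%:R * a))).
    rewrite ler_pM ?ler0n //; first exact: p_le.
    by rewrite -natrM ler_nat.
  have -> : x * L / a * (k%:R * a) = k%:R * (x * L) by field; rewrite gt_eqF.
  by apply: ler_wpM2l => //; apply: ler_wpM2r; [exact: ltW | lra].
- move=> k r u s hk us ks ru.
  have -> : 1 - p = miss n d L by ring.
  rewrite missX /psi ler_expR lerN2; apply: ler_wpM2l; first by apply: mulr_ge0; [lra | exact: ltW].
  set beta := (16 * D)^-1.
  have b0 : 0 < beta by rewrite invr_gt0; lra.
  have b1 : beta <= 1 by rewrite invf_le1; lra.
  have bD : beta * (16 * D) = 1 by rewrite mulVf //; lra.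
  have s1 : (1 - beta) * (r%:R - z * k%:R) <= s%:R / a.
    apply: (@le_trans _ _ ((1 - beta) * u%:R)).
      by rewrite ler_wpM2l ?subr_ge0 // lerBlDr.
    have bE : (b.-1)%:R = 16 * D - 1 :> R.
      by rewrite -subn1 natrB ?muln_gt0 ?(leq_trans _ d2) // natrM.
    rewrite ler_pdivlMr //; move: us; rewrite -(ler_nat R) !natrM bE => us.
    have -> : (1 - beta) * u%:R * a = beta * (u%:R * (a * (16 * D - 1))).
      by transitivity ((beta * (16 * D) - beta) * u%:R * a); [rewrite bD | ring].
    have -> : s%:R = beta * (16 * D * s%:R) by rewrite mulrA bD mul1r.
    by rewrite ler_wpM2l // ltW.
  have s2 : k%:R / (D + 1) <= s%:R / a.
    rewrite ler_pdivrMr ?ltr_wpDl // mulrAC ler_pdivlMr //.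
    have an' : a <= n%:R by rewrite ler_nat leq_subr.
    move: ks; rewrite -(ler_nat R) !natrM -natr1.
    have : k%:R * a <= k%:R * n%:R by rewrite ler_wpM2l.
    by lra.
  have -> : (1 - beta) ^+ 2 * (r%:R - z * k%:R) + beta * (k%:R / (D + 1)) =
     (1 - beta) * ((1 - beta) * (r%:R - z * k%:R)) + beta * (k%:R / (D + 1)) by ring.
  have b1' : 0 <= 1 - beta by rewrite subr_ge0.
  have h1 := ler_wpM2l b1' s1; have h2 := ler_wpM2l (ltW b0) s2.
  by apply: le_trans (lerD h1 h2) _; rewrite -mulrDl subrK mul1r.
apply: ler_sum => k hk.
have kL4 := kk k hk.
have k0 : 0 < k%:R :> R by apply: lt_le_trans kL4; exact: expR_gt0.
have T1 : (V ^ m k)%N%:R <= expR (c0 * L * k%:R) :> R.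
  rewrite natrX; apply: (@le_trans _ _ (expR (D * L) ^+ m k)).
    by rewrite lerXn2r ?nnegrE ?expR_ge0 ?ler0n // V_le.
  rewrite -expRM_natr ler_expR mulrAC [leRHS]mulrAC; apply: ler_wpM2r; first exact: ltW.
  rewrite -(ler_pM2r a0) -mulrA; apply: le_trans (ler_wpM2l _ (m1 k)) _; first by lra.
  have : k%:R * (d * A)%:R <= k%:R * (c0 * a) by rewrite ler_wpM2l // ltW.
  by rewrite [(d * A)%:R]natrM; lra.
have T2 : (2 ^ (m k * (d * n)))%N%:R <= expR ((2 * A * d)%:R * k%:R) :> R.
  rewrite natrX; apply: (@le_trans _ _ (expR 1 ^+ (m k * (d * n)))).
    by rewrite lerXn2r ?nnegrE ?expR_ge0 //; have := expR_ge1Dx (1 : R); lra.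
  rewrite -expRM_natr mul1r ler_expR !natrM.
  have h : (m k)%:R * n%:R <= (m k)%:R * (2 * a) by rewrite ler_wpM2l.
  have : D * ((m k)%:R * n%:R) <= D * (2 * (k%:R * A%:R)).
    rewrite ler_wpM2l //; apply: le_trans h _; have := m1 k; lra.
  by rewrite !natrM; lra.
have V0 : (0 < V)%N by rewrite bin_gt0 (leq_trans _ dn) // leq_pmull.
(* Here [k >= n ^ (1/4)] gives [V / k <= n ^ (D - 1/4)], and the [k.+1] summands cost one more
   [expR k]. *)
have T3 : \sum_(r < k.+1) 'C(V, r)%:R * psi k r <= expR (2 * k%:R - 6 * c0 * L * k%:R).
  apply: (@le_trans _ _ (\sum_(r < k.+1) expR (k%:R - 6 * c0 * L * k%:R))).
    apply: ler_sum => r _.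
    have kN0 : (0 < k)%N by rewrite -(ltr0n R).
    apply: le_trans (ler_wpM2r (expR_ge0 _) (bin_le_expR R r kN0 V0)) _.
    have h : (V%:R / k%:R) ^+ r <= expR ((D - 4^-1) * L * r%:R).
      rewrite expRM_natr lerXn2r ?nnegrE ?expR_ge0 ?divr_ge0 //.
      rewrite ler_pdivrMr //; apply: le_trans (V_le d nL) _.
      have -> : D * L = (D - 4^-1) * L + L / 4 by field.
      by rewrite expRD ler_wpM2l ?expR_ge0.
    rewrite /psi -[leLHS]mulrA -expRD; apply: le_trans (ler_wpM2r (expR_ge0 _) h) _.
    rewrite -expRD ler_expR.
    have := exponent_bound D2 (ler0n R r) (ltW k0).
    move=> /(ler_wpM2l (ltW Lp)); lra.
  rewrite sumr_const card_ord -[leLHS]mulr_natl.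
  have -> : 2 * k%:R - 6 * c0 * L * k%:R = k%:R + (k%:R - 6 * c0 * L * k%:R) by ring.
  rewrite [leRHS]expRD ler_wpM2r ?expR_ge0 // -natr1 addrC; exact: expR_ge1Dx.
have T4 : W k <= expR (c0 * L * k%:R + k%:R).
  rewrite /W expRD ler_wpM2r ?expR_ge0 // exprM expRM_natr.
  by rewrite lerXn2r ?nnegrE ?expR_ge0 ?exprn_ge0 // (le_trans ler01).
have W0 : 0 <= W k by rewrite mulr_ge0 ?expR_ge0 ?exprn_ge0 // (le_trans ler01).
apply: (@le_trans _ _ (expR (c0 * L * k%:R) * expR ((2 * A * d)%:R * k%:R)
   * expR (2 * k%:R - 6 * c0 * L * k%:R) * expR (c0 * L * k%:R + k%:R))).
  have S0 : 0 <= \sum_(r < k.+1) 'C(V, r)%:R * psi k r.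
    by apply: sumr_ge0 => r _; rewrite mulr_ge0 ?expR_ge0.
  apply: ler_pM T4 => //; first by rewrite !mulr_ge0.
  apply: ler_pM T3 => //; first by rewrite !mulr_ge0.
  by apply: ler_pM T1 T2.
rewrite -!expRD -expRM_natr ler_expR.
have := ler_wpM2r (ltW k0) cst; rewrite natrD mulrDl.
have : 0 <= c0 * L * k%:R by rewrite !mulr_ge0 // ltW.
lra.
Qed.

End Large.

(** * Asymptotics and conclusion *)

Section Eventually.
Variable R : realType.

Definition eventually (P : R -> Prop) := exists M, forall L, M <= L -> P L.

Lemma eventually_and (P Q : R -> Prop) :
  eventually P -> eventually Q -> eventually (fun L => P L /\ Q L).
Proof.
move=> [M HM] [N HN]; exists (Num.max M N) => L; rewrite ge_max => /andP[ML NL].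
by split; [exact: HM | exact: HN].
Qed.

Lemma eventually_linear (c K : R) : 0 < c -> eventually (fun L => K <= c * L).
Proof. by move=> c0; exists (K / c) => L; rewrite ler_pdivrMr // mulrC. Qed.

Lemma eventually_expR (c K : R) : 0 < c -> eventually (fun L => K <= expR (c * L)).
Proof.
move=> c0; have [M HM] := eventually_linear K c0; exists M => L /HM h.
by apply: le_trans h _; have := expR_ge1Dx (c * L); lra.
Qed.

(** Split the exponential into two equal factors, each at least [c / 2 * L]. *)
Lemma eventually_linear_expR (c K : R) : 0 < c -> 0 <= K -> eventually (fun L => K * L <= expR (c * L)).
Proof.
move=> c0 K0; have [M HM] := eventually_linear (K / (c / 2)) (divr_gt0 c0 (ltr0n R 2)).
exists (Num.max 0 M) => L; rewrite ge_max => /andP[L0 /HM h].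
have -> : c * L = c / 2 * L + c / 2 * L by field.
have := expR_ge1Dx (c / 2 * L); rewrite expRD => e.
have cL : 0 <= c / 2 * L by rewrite mulr_ge0 // divr_ge0 // ltW.
apply: (@le_trans _ _ ((c / 2 * L) * (c / 2 * L))); last by rewrite ler_pM //; lra.
by rewrite mulrA ler_wpM2r // -ler_pdivrMr ?divr_gt0.
Qed.

Lemma eventually_powX_expR (c K : R) m : 0 < c -> 0 <= K ->
  eventually (fun L => (K * L) ^+ m.+1 <= expR (c * L)).
Proof.
move=> c0 K0; have cm : 0 < c / m.+1%:R by rewrite divr_gt0.
have [M HM] := eventually_linear_expR cm K0.
exists (Num.max 0 M) => L; rewrite ge_max => /andP[L0 /HM h].
have E : c * L = c / m.+1%:R * L * m.+1%:R by rewrite mulrAC divfK // pnatr_eq0.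
by rewrite E expRM_natr; apply: lerXn2r h; rewrite nnegrE ?expR_ge0 ?mulr_ge0.
Qed.

Lemma eventually_expRN (c K eps : R) : 0 < c -> 0 < K -> 0 < eps ->
  eventually (fun L => K * expR (- (c * L)) < eps).
Proof.
move=> c0 K0 e0; have [M HM] := eventually_expR (2 * K / eps) c0; exists M => L /HM h.
rewrite expRN ltr_pdivrMr ?expR_gt0 //; move: h; rewrite ler_pdivrMr // mulrC.
by have : 0 < eps * expR (c * L); [rewrite mulr_gt0 ?expR_gt0 | lra].
Qed.

Lemma good_failure_small d (eps : R) : (2 <= d)%N -> 0 < eps ->
  exists n0 : nat, forall n : nat, (n0 <= n)%N ->
    exists kappa (p : R), [/\ (d < n)%N, 0 <= p, p <= 1 &
      rprob (ksets n d.+1) p (fun Y => ~~ good d kappa Y) < eps].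
Proof.
move=> d2 eps0; have D2 := D_ge2 R d2.
pose c0 : R := (128 * (d%:R + 1))^-1.
have c00 : 0 < c0 by rewrite invr_gt0; lra.
have c78 : 0 < 7 / 8 :> R by lra.
have c34 : 0 < 3 / 4 :> R by lra.
have c4 : 0 < 4^-1 :> R by lra.
have c8 : 0 < 8^-1 :> R by lra.
have c16 : 0 < 16^-1 :> R by lra.
pose A := (16 * d * (128 * d * d.+1))%N.
have D0 : 0 <= d%:R :> R by [].
have e3 : 0 < eps / 3 by lra.
have [M HM] := eventually_and (eventually_linear 1 ltr01)
 (eventually_and (eventually_expR (2 ^ d * d`!)%:R c16)
 (eventually_and (eventually_linear_expR ltr01 (mulr_ge0 (ler0n R 4) D0))
 (eventually_and (eventually_expR (2 * d%:R) c78)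
 (eventually_and (eventually_expR d%:R c16)
 (eventually_and (eventually_expR (64 * d%:R) c34)
 (eventually_and (eventually_expR 2 c8)
 (eventually_and (eventually_powX_expR (4 * d.+2 ^ 2).-1 c00 D0)
 (eventually_and (eventually_linear (2 * A * d + 3)%:R c00)
 (eventually_and (eventually_expR (2 * (d * A)%:R / c0) ltr01)
 (eventually_and (eventually_expR 2 c00)
 (eventually_and (eventually_expR (2 * d%:R) ltr01)
 (eventually_and (eventually_expRN c16 (ltr0n R 2) e3)
 (eventually_and (eventually_expRN c4 (ltr0n R 4) e3)
   (eventually_expRN c00 (ltr0n R 2) e3)))))))))))))).
exists (Num.truncn (expR M)).+1 => n n0n.
have nM : expR M < n%:R.
  have /andP[_ h] := truncn_itv (expR_ge0 M).
  by apply: lt_le_trans h _; rewrite ler_nat.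
have nR : 0 < n%:R :> R by apply: lt_trans nM; exact: expR_gt0.
pose L : R := ln n%:R.
have nL : n%:R = expR L by rewrite lnK.
have ML : M <= L by rewrite -ler_expR -nL ltW.
have [L1 [h1 [h2 [h3 [h4 [h5 [h6 [h7 [h8 [h9 [h10 [h11 [h12 [h13 h14]]]]]]]]]]]]]] := HM L ML.
rewrite mul1r in L1 h2 h9 h11.
have L0 : 0 < L by lra.
have comm c : c^-1 * L = L / c by rewrite mulrC.
rewrite ?comm in h1 h4 h6 h12 h13.
have dn : (2 * d <= n)%N by rewrite -(ler_nat R) nL natrM.
(* The threshold between small and large supports is [n ^ (1/4)]: [k1] serves the former, [k2] the
   latter. *)
pose kappa := Num.truncn (expR (L / 4)).
have /andP[k1 k2] := truncn_itv (expR_ge0 (L / 4)).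
have p0 := p_ge0 n d2 L0; have p1 := p_le1 n d L.
exists kappa, (1 - miss n d L); split=> //; first by apply: leq_trans dn; rewrite ltn_Pmull // (leq_trans _ d2).
have b1 := isolated_bad d2 nL dn L0 h1 h2 h3.
have b2 := small_bad_le d2 nL dn L0 k1 h4 h5 h6.
have b3 : rprob (ksets n d.+1) (1 - miss n d L) (large_bad d kappa) <= 2 * expR (- (c0 * L)).
  apply: large_bad_le => //.
  - have := ler_pM ler01 ler01 (_ : 1 <= d%:R :> R) L1; rewrite mulr1; apply; lra.
  - move: h9; rewrite ler_pdivrMr // => h9.
    have := a_ge d2 dn L0; rewrite nL => an.
    have : expR L * c0 <= 2 * (n - d)%:R * c0 by rewrite ler_wpM2r // ltW.
    by rewrite -/c0 -/A; lra.
apply: (@le_lt_trans _ _ (rprob (ksets n d.+1) (1 - miss n d L)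
  (fun Y => small_bad d kappa Y || (large_bad d kappa Y || ~~ has_isolated d Y)))).
  by apply: rprob_le => // Y _; rewrite /good !negb_and !negbK.
apply: le_lt_trans (rprob_orb _ _ _ _ _) _ => //.
have := rprob_orb (ksets n d.+1) p0 p1 (large_bad d kappa) (fun Y => ~~ has_isolated d Y).
lra.
Qed.

End Eventually.

Theorem theorem1 (d : nat) (hd : (2 <= d)%N) :
  forall eps : rat, 0 < eps ->
  exists n0 : nat, forall n : nat, (n0 <= n)%N ->
    `|1 - LMprob (@hitting_times_coincide n d)| < eps.
Proof.
(* The process has rational probabilities, but [p] involves an exponential, so the comparison takes
   place in the reals. *)
move=> eps eps0; pose R : realType := Rdefinitions.R.
have eR : 0 < ratr eps :> R by rewrite ltr0q.
have [n0 H] := good_failure_small hd eR.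
exists n0 => n /H [kappa [p [dn p0 p1 bad]]].
rewrite ger0_norm ?subr_ge0 ?LMprob_le1 // -(ltr_rat R).
apply: le_lt_trans bad; apply: LMprob_transfer => // w m tw mN.
rewrite negbK; apply: good_coincide => //; exact: ltnW.
Qed.
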